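(* Let $\ell,T>0$, and let the coefficients $\mathbf M,\mathbf C,\mathbf C_\tau,\mathbf E$, with $\mathbf\Gamma=\operatorname{diag}(\mathbf M,\mathbf C)$ and $\mathbf H=\mathbf C_\tau\mathbf C^{-1}$, satisfy the standing hypotheses in the context ($\mathbf\Gamma$, $\mathbf H$ time-independent and uniformly symmetric positive definite), with material coefficients continuous across element interfaces. Let $(\mathbf u_h,\mathbf r_{\tau h})$, with $\mathbf u_h\in H^1(0,T;V_h^k)$, $\mathbf r_{\tau h}\in L^2(0,T;W_h^k)$ and $\mathbf u_h(\cdot,0)=\mathbf u_{h,0}\in V_h^k$, solve the global semi-discrete DG formulation (DG1)–(DG2) of the context (all element inner products evaluated exactly), where: (i) at interior interfaces the characteristic flux $\widehat{\mathbf\Pi\mathbf u_h}=\mathbf\Pi\{\!\{\mathbf u_h\}\!\}+\frac\sigma2\mathbf\Gamma|\mathbf A|[\![\mathbf u_h]\!]$ is used with some $\sigma\ge0$; (ii) at interior interfaces $\widehat{\mathbf\Pi\mathbf r_h}=\mathbf\Pi(\mathbf 0_6^\top,\widehat{\mathbf r_{\tau h}}^\top)^\top$, and the auxiliary traces $\widehat{\mathbf u_{1h}},\widehat{\mathbf r_{\tau h}}$ are either the alternating pair $\widehat{\mathbf u_{1h}}=\mathbf u_{1h}^-$, $\widehat{\mathbf r_{\tau h}}=\mathbf r_{\tau h}^+$, or the central BR1 pair $\widehat{\mathbf u_{1h}}=\{\!\{\mathbf u_{1h}\}\!\}$, $\widehat{\mathbf r_{\tau h}}=\{\!\{\mathbf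 r_{\tau h}\}\!\}$, or any pair satisfying at every interior interface $$\widehat{\mathbf r_{\tau h}}^\top[\![\mathbf u_{1h}]\!]+\widehat{\mathbf u_{1h}}^\top[\![\mathbf r_{\tau h}]\!]=[\![\mathbf u_{1h}^\top\mathbf r_{\tau h}]\!];$$ (iii) at the physical boundaries $x=0,\ell$ the flux $\widehat{\mathbf\Pi\mathbf u_h}$ is given by the formula in (i) with $\sigma=1$ and the homogeneous outer states $$\mathbf u_h^-(0,t)=\begin{bmatrix}\mathbf 0_6\\ \mathbf u_{2h}^++\mathbf S_0\mathbf u_{1h}^+\end{bmatrix}_{x=0},\qquad \mathbf u_h^+(\ell,t)=\begin{bmatrix}\mathbf u_{1h}^--\mathbf S_\ell\mathbf u_{2h}^-\\ \mathbf 0_6\end{bmatrix}_{x=\ell},$$ and the auxiliary boundary traces are $\widehat{\mathbf u_{1h}}=\mathbf 0_6$, $\widehat{\mathbf\Pi\mathbf r_h}=\mathbf\Pi\mathbf r_h^+$ at $x=0$, and $\widehat{\mathbf u_{1h}}=\mathbf u_{1h}^-$, $\widehat{\mathbf\Pi\mathbf r_h}=\mathbf 0_{12}$ at $x=\ell$. Set $B(t)=(\mathbf u_{1h}^+)^\top\mathbf S_0\mathbf u_{1h}^+\big|_{x=0}+(\mathbf u_{2h}^-)^\top\mathbf S_\ell\mathbf u_{2h}^-\big|_{x=\ell}\ge0$. Then, for almost every $t\in(0,T)$, $$\frac12\frac{d}{dt}\|\mathbf u_h\|_{\mathbf\Gamma}^2+\sum_{i=1}^{N_c-1}\Bigl(\tfrac\sigma2\mathbf\Gamma|\mathbf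 A|[\![\mathbf u_h]\!]\Bigr)^\top[\![\mathbf u_h]\!]\Big|_{x_i}+\sum_{i=1}^{N_c}(\mathbf H^{-1}\mathbf r_{\tau h},\mathbf r_{\tau h})_{\Omega_i}+B(t)=\sum_{i=1}^{N_c}(\mathbf u_h,\mathbf q_{\rm ext})_{\Omega_i}.$$ If additionally $\mathbf q_{\rm ext}\in L^2(0,T;L^2_{\mathbf\Gamma^{-1}}(\Omega)^{12})$, then $$\|\mathbf u_h(\cdot,T)\|_{\mathbf\Gamma}^2+2\int_0^T\sum_{i=1}^{N_c-1}\Bigl(\tfrac\sigma2\mathbf\Gamma|\mathbf A|[\![\mathbf u_h]\!]\Bigr)^\top[\![\mathbf u_h]\!]\Big|_{x_i}dt+2\int_0^T\sum_{i=1}^{N_c}(\mathbf H^{-1}\mathbf r_{\tau h},\mathbf r_{\tau h})_{\Omega_i}dt+2\int_0^TB(t)\,dt\le e^T\left(\|\mathbf u_{h,0}\|_{\mathbf\Gamma}^2+\int_0^T\|\mathbf q_{\rm ext}(\cdot,t)\|_{\mathbf\Gamma^{-1}}^2dt\right).$$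
   Context: Dots denote $\partial_t$, primes denote $\partial_x$ (elementwise for discrete functions); $[g]_a^b=g(b)-g(a)$. Algebra: for $\mathbf a\in\mathbb R^3$, $\tilde{\mathbf a}\in\mathbb R^{3\times3}$ is the skew matrix with $\tilde{\mathbf a}\mathbf b=\mathbf a\times\mathbf b$. For $\mathbf c=(\mathbf c_1^\top,\mathbf c_2^\top)^\top\in\mathbb R^6$, $$\mathcal L_1(\mathbf c)=\begin{bmatrix}\tilde{\mathbf c}_2&\mathbf 0\\ \tilde{\mathbf c}_1&\tilde{\mathbf c}_2\end{bmatrix},\qquad \mathcal L_2(\mathbf c)=\begin{bmatrix}\mathbf 0&\tilde{\mathbf c}_1\\ \tilde{\mathbf c}_1&\tilde{\mathbf c}_2\end{bmatrix};$$ $\mathcal L_1^\top(\mathbf c)$ is the transpose of $\mathcal L_1(\mathbf c)$. Coefficients (standing hypotheses): $\mathbf M,\mathbf C,\mathbf C_\tau:[0,\ell]\to\mathbb R^{6\times6}$ are time-independent and sufficiently smooth in $x$ (in particular continuous on $[0,\ell]$); $\mathbf M$, $\mathbf C$ and $\mathbf H:=\mathbf C_\tau\mathbf C^{-1}$ are uniformly symmetric positive definite (symmetric, with $z^\top A(x)z\ge c|z|^2$, $c>0$ independent of $x$). $\mathbf E(x)=\begin{bmatrix}\tilde{\boldsymbol\kappa}_0(x)&\mathbf 0\\ \tilde{\mathbf e}_1&\tilde{\boldsymbol\kappa}_0(x)\end{bmatrix}$ with $\boldsymbol\kappa_0:[0,\ell]\to\mathbb R^3$ given and sufficiently smooth,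 $\mathbf e_1=(1,0,0)^\top$. Further, $$\mathbf\Gamma=\begin{bmatrix}\mathbf M&\mathbf 0\\ \mathbf 0&\mathbf C\end{bmatrix},\quad \mathbf\Pi=\begin{bmatrix}\mathbf 0&-\mathbf I_6\\-\mathbf I_6&\mathbf 0\end{bmatrix},\quad \mathbf A=\mathbf\Gamma^{-1}\mathbf\Pi .$$ $\mathbf A$ is real diagonalizable, $\mathbf A=\mathbf T\mathbf\Lambda\mathbf T^{-1}$, and $|\mathbf A|:=\mathbf T|\mathbf\Lambda|\mathbf T^{-1}$ with $|\mathbf\Lambda|$ the diagonal matrix of absolute values. With $\mathbf\Psi=\mathbf C^{-1/2}\mathbf M^{-1}\mathbf C^{-1/2}$ (principal square roots throughout), $\mathbf S_0=\mathbf C^{-1/2}\mathbf\Psi^{-1/2}\mathbf C^{-1/2}$ and $\mathbf S_\ell=\mathbf C^{1/2}\mathbf\Psi^{1/2}\mathbf C^{1/2}$, evaluated at the point where they occur. Load: $\mathbf f_e:[0,\ell]\times[0,T]\to\mathbb R^6$ given (such that the integrals below are defined), $\mathbf q_{\rm ext}=(\mathbf f_e^\top,\mathbf 0_6^\top)^\top$. Source: for $\mathbf u=(\mathbf u_1^\top,\mathbf u_2^\top)^\top$ and $\mathbf r=(\mathbf 0_6^\top,\mathbf r_\tau^\top)^\top$, $$\mathbf Q(\mathbf u,\mathbf r)=\begin{bmatrix}\mathbf E\mathbf u_2+\mathbf E\mathbf r_\tau-\mathcal L_1(\mathbf u_1)\mathbf M\mathbf u_1-\mathcal L_2(\mathbf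 u_2)\mathbf C\mathbf u_2-\mathcal L_2(\mathbf r_\tau)\mathbf C\mathbf u_2\\ -\mathbf E^\top\mathbf u_1+\mathcal L_1^\top(\mathbf u_1)\mathbf C\mathbf u_2\end{bmatrix}+\mathbf q_{\rm ext}.$$ Mesh and spaces: $0=x_0<x_1<\dots<x_{N_c}=\ell$, $\Omega_i=[x_{i-1},x_i]$, $\Omega=[0,\ell]$; interior interfaces are $x_1,\dots,x_{N_c-1}$. $P_k(\Omega_i)$ denotes polynomials of degree at most $k$. $V_h^k=\{\mathbf v_h\in L^2(\Omega)^{12}:\mathbf v_h|_{\Omega_i}\in P_k(\Omega_i)^{12}\ \forall i\}$, $W_h^k=\{\mathbf w_h\in L^2(\Omega)^{6}:\mathbf w_h|_{\Omega_i}\in P_k(\Omega_i)^{6}\ \forall i\}$. $(\cdot,\cdot)_{\Omega_i}$ is the $L^2(\Omega_i)$ inner product. Write $\mathbf u_h=(\mathbf u_{1h}^\top,\mathbf u_{2h}^\top)^\top$, $\mathbf r_h=(\mathbf 0_6^\top,\mathbf r_{\tau h}^\top)^\top$. Traces: $w^\mp(x_i)$ are the left/right limits at $x_i$, $[\![w]\!]=w^--w^+$, $\{\!\{w\}\!\}=\frac12(w^-+w^+)$. At $x=0$ the interior trace is $w^+$ and at $x=\ell$ it is $w^-$; the missing exterior traces of $\mathbf u_h$ are the prescribed outer states. In expressions $[\,\cdot\,]_0^\ell$ below, un-hatted discrete functions are evaluated by their interior traces. Semi-discrete formulation: for a.e. $t\in(0,T)$ and all $(\mathbf v_h,\mathbf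 w_h)\in V_h^k\times W_h^k$, (DG1) $$\sum_{i=1}^{N_c}(\mathbf\Gamma\dot{\mathbf u}_h,\mathbf v_h)_{\Omega_i}=\mathcal A_h(\mathbf u_h,\mathbf v_h)+\mathcal B_h(\mathbf r_h,\mathbf v_h)+\sum_{i=1}^{N_c}(\mathbf Q(\mathbf u_h,\mathbf r_h),\mathbf v_h)_{\Omega_i},$$ (DG2) $$\sum_{i=1}^{N_c}(\mathbf H^{-1}\mathbf r_{\tau h},\mathbf w_h)_{\Omega_i}=\mathcal C_h(\mathbf u_{1h},\mathbf w_h)-\sum_{i=1}^{N_c}(\mathbf E^\top\mathbf u_{1h},\mathbf w_h)_{\Omega_i}+\sum_{i=1}^{N_c}(\mathcal L_1^\top(\mathbf u_{1h})\mathbf C\mathbf u_{2h},\mathbf w_h)_{\Omega_i},$$ where $$\mathcal A_h(\mathbf u_h,\mathbf v_h)=\sum_{i=1}^{N_c}(\mathbf\Pi\mathbf u_h,\mathbf v_h')_{\Omega_i}-\sum_{i=1}^{N_c-1}\widehat{\mathbf\Pi\mathbf u_h}^\top[\![\mathbf v_h]\!]\big|_{x_i}-\bigl[\widehat{\mathbf\Pi\mathbf u_h}^\top\mathbf v_h\bigr]_0^\ell,$$ $$\mathcal B_h(\mathbf r_h,\mathbf v_h)=\sum_{i=1}^{N_c}(\mathbf\Pi\mathbf r_h,\mathbf v_h')_{\Omega_i}-\sum_{i=1}^{N_c-1}\widehat{\mathbf\Pi\mathbf r_h}^\top[\![\mathbf v_h]\!]\big|_{x_i}-\bigl[\widehat{\mathbf\Pi\mathbf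 r_h}^\top\mathbf v_h\bigr]_0^\ell,$$ $$\mathcal C_h(\mathbf u_{1h},\mathbf w_h)=\sum_{i=1}^{N_c-1}\widehat{\mathbf u_{1h}}^\top[\![\mathbf w_h]\!]\big|_{x_i}+\bigl[\widehat{\mathbf u_{1h}}^\top\mathbf w_h\bigr]_0^\ell-\sum_{i=1}^{N_c}(\mathbf u_{1h},\mathbf w_h')_{\Omega_i}.$$ Norms: $\|\mathbf u_h\|_{\mathbf\Gamma}^2=\sum_{i=1}^{N_c}(\mathbf\Gamma\mathbf u_h,\mathbf u_h)_{\Omega_i}$; $\|\mathbf g\|_{\mathbf\Gamma^{-1}}^2=\int_\Omega\mathbf g^\top\mathbf\Gamma^{-1}\mathbf g\,dx$, with $L^2_{\mathbf\Gamma^{-1}}(\Omega)^{12}$ the measurable $\mathbf g$ for which it is finite. *)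

(* Defs.v *)
From HB Require Import structures.
From mathcomp Require Import all_boot all_order all_algebra.
From mathcomp Require Import all_classical all_reals all_analysis.

Set Implicit Arguments.
Unset Strict Implicit.
Unset Printing Implicit Defensive.

Import Order.TTheory GRing.Theory Num.Theory.
Import numFieldNormedType.Exports.

Local Open Scope classical_set_scope.
Local Open Scope ring_scope.

Definition dotv (R : realType) n (a b : 'cV[R]_n) : R := (a^T *m b) 0 0.

Definition tilde (R : realType) (a : 'cV[R]_3) : 'M[R]_3 :=
  let a1 := a (inord 0) 0 in
  let a2 := a (inord 1) 0 in
  let a3 := a (inord 2) 0 in
  \matrix_(i < 3, j < 3)
    (nth [::] [:: [::    0; - a3;   a2];
                  [::   a3;    0; - a1];
                  [:: - a2;   a1;    0]] i)`_j.

Definition L1 (R : realType) (c : 'cV[R]_(3 + 3)) : 'M[R]_(3 + 3) :=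
  block_mx (tilde (dsubmx c)) 0 (tilde (usubmx c)) (tilde (dsubmx c)).

Definition L2 (R : realType) (c : 'cV[R]_(3 + 3)) : 'M[R]_(3 + 3) :=
  block_mx 0 (tilde (usubmx c)) (tilde (usubmx c)) (tilde (dsubmx c)).

Definition spd (R : realType) n (A : 'M[R]_n) : Prop :=
  A^T = A /\ forall z : 'cV[R]_n, z != 0 -> 0 < dotv z (A *m z).

(* Principal square root of a symmetric positive definite matrix: its unique
   symmetric positive definite square root. *)
Definition sqrtmx (R : realType) n (A : 'M[R]_n) : 'M[R]_n :=
  xget 0 [set P : 'M[R]_n | spd P /\ P *m P = A].

(* |A| = T |Lambda| T^-1 for a real diagonalization A = T Lambda T^-1; the
   value does not depend on the diagonalization chosen. *)
Definition absmx (R : realType) n (A : 'M[R]_n) : 'M[R]_n :=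
  xget 0 [set B : 'M[R]_n | exists (T : 'M[R]_n) (lam : 'rV[R]_n),
    [/\ T \in unitmx,
        A = T *m diag_mx lam *m invmx T &
        B = T *m diag_mx (map_mx (fun a => `|a|) lam) *m invmx T]].

(* Coefficient functions are only meaningful on [0, ell]. *)
Definition unif_spd (R : realType) n (ell : R) (A : R -> 'M[R]_n) : Prop :=
  (forall x, x \in `[0, ell] -> (A x)^T = A x) /\
  exists2 c : R, 0 < c & forall x, x \in `[0, ell] ->
    forall z : 'cV[R]_n, c * dotv z z <= dotv z (A x *m z).

Record beam (R : realType) := Beam {
  ell : R;
  Mass : R -> 'M[R]_(3 + 3);
  Comp : R -> 'M[R]_(3 + 3);
  Ctau : R -> 'M[R]_(3 + 3);
  kappa0 : R -> 'cV[R]_3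
}.

Definition Hmx (R : realType) (b : beam R) (x : R) : 'M[R]_(3 + 3) :=
  Ctau b x *m invmx (Comp b x).

Definition Emx (R : realType) (b : beam R) (x : R) : 'M[R]_(3 + 3) :=
  block_mx (tilde (kappa0 b x)) 0
           (tilde (delta_mx 0 0)) (tilde (kappa0 b x)).

Definition Gam (R : realType) (b : beam R) (x : R)
  : 'M[R]_((3 + 3) + (3 + 3)) := block_mx (Mass b x) 0 0 (Comp b x).

Definition Pimx (R : realType) : 'M[R]_((3 + 3) + (3 + 3)) :=
  block_mx 0 (- 1%:M) (- 1%:M) 0.

Definition Amx (R : realType) (b : beam R) (x : R)
  : 'M[R]_((3 + 3) + (3 + 3)) := invmx (Gam b x) *m Pimx R.

Definition Psi (R : realType) (b : beam R) (x : R) : 'M[R]_(3 + 3) :=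
  invmx (sqrtmx (Comp b x)) *m invmx (Mass b x) *m invmx (sqrtmx (Comp b x)).

Definition S0 (R : realType) (b : beam R) : 'M[R]_(3 + 3) :=
  invmx (sqrtmx (Comp b 0)) *m invmx (sqrtmx (Psi b 0))
  *m invmx (sqrtmx (Comp b 0)).

Definition Sell (R : realType) (b : beam R) : 'M[R]_(3 + 3) :=
  sqrtmx (Comp b (ell b)) *m sqrtmx (Psi b (ell b)) *m sqrtmx (Comp b (ell b)).

Definition standing_hyps (R : realType) (b : beam R) : Prop :=
  [/\ [/\ {within `[0, ell b], continuous (Mass b)},
          {within `[0, ell b], continuous (Comp b)},
          {within `[0, ell b], continuous (Ctau b)} &
          {within `[0, ell b], continuous (kappa0 b)}],
      unif_spd (ell b) (Mass b),
      unif_spd (ell b) (Comp b) &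
      unif_spd (ell b) (Hmx b)].

(* The nodes are x_0, ..., x_ncells and the cells Omega_i = [x_{i-1}, x_i] are
   numbered from 1 to ncells; node x_i is the right end of cell i and the left
   end of cell i.+1. *)
Record mesh (R : realType) := Mesh { ncells : nat; node : nat -> R }.

Definition mesh_of (R : realType) (m : mesh R) (l : R) : Prop :=
  [/\ (0 < ncells m)%N, node m 0%N = 0, node m (ncells m) = l &
      forall i, (i < ncells m)%N -> node m i < node m i.+1].

(* A broken polynomial vector field is given by its restrictions to the cells:
   v i is the polynomial on cell i (values for i outside 1..ncells are
   irrelevant).  As the cells have positive length, this is the same as its
   class in L^2(Omega)^n. *)
Definition broken (R : realType) (n : nat) := nat -> 'cV[{poly R}]_n.

Definition in_Vh (R : realType) n (m : mesh R) (k : nat) (v : broken R n)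
  : Prop :=
  forall i, (1 <= i <= ncells m)%N -> forall j, (size (v i j 0%R) <= k.+1)%N.

Definition ev (R : realType) n (p : 'cV[{poly R}]_n) (y : R) : 'cV[R]_n :=
  map_mx (fun q : {poly R} => q.[y]) p.

Definition dx (R : realType) n (p : 'cV[{poly R}]_n) : 'cV[{poly R}]_n :=
  map_mx (fun q : {poly R} => q^`()) p.

Definition dt (R : realType) n (u : R -> broken R n) (t : R) (i : nat) (y : R)
  : 'cV[R]_n := \col_j derive1 (fun s => ev (u s i) y j 0) t.

Definition up1 (R : realType) (u : broken R ((3 + 3) + (3 + 3)))
  : broken R (3 + 3) := fun i => usubmx (u i).

Definition dn2 (R : realType) (u : broken R ((3 + 3) + (3 + 3)))
  : broken R (3 + 3) := fun i => dsubmx (u i).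

Definition rfull (R : realType) (r : broken R (3 + 3))
  : broken R ((3 + 3) + (3 + 3)) := fun i => col_mx 0 (r i).

Definition trm (R : realType) n (m : mesh R) (v : broken R n) (i : nat)
  : 'cV[R]_n := ev (v i) (node m i).

Definition trp (R : realType) n (m : mesh R) (v : broken R n) (i : nat)
  : 'cV[R]_n := ev (v i.+1) (node m i).

Definition jump (R : realType) n (m : mesh R) (v : broken R n) (i : nat)
  : 'cV[R]_n := trm m v i - trp m v i.

Definition avg (R : realType) n (m : mesh R) (v : broken R n) (i : nat)
  : 'cV[R]_n := 2^-1 *: (trm m v i + trp m v i).

Definition ip (R : realType) n (m : mesh R) (i : nat) (f g : R -> 'cV[R]_n)
  : R :=
  \int[@lebesgue_measure R]_(y in `[node m i.-1, node m i]) dotv (f y) (g y).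

Definition charflux (R : realType) (b : beam R) (sigma x : R)
    (um up : 'cV[R]_((3 + 3) + (3 + 3))) : 'cV[R]_((3 + 3) + (3 + 3)) :=
  Pimx R *m (2^-1 *: (um + up))
  + (sigma / 2) *: (Gam b x *m absmx (Amx b x) *m (um - up)).

Definition outer0 (R : realType) (b : beam R) (m : mesh R)
    (u : broken R ((3 + 3) + (3 + 3))) : 'cV[R]_((3 + 3) + (3 + 3)) :=
  col_mx 0 (trp m (dn2 u) 0 + S0 b *m trp m (up1 u) 0).

Definition outerl (R : realType) (b : beam R) (m : mesh R)
    (u : broken R ((3 + 3) + (3 + 3))) : 'cV[R]_((3 + 3) + (3 + 3)) :=
  col_mx (trm m (up1 u) (ncells m) - Sell b *m trm m (dn2 u) (ncells m)) 0.

Definition Piu_hat (R : realType) (b : beam R) (m : mesh R) (sigma : R)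
    (u : broken R ((3 + 3) + (3 + 3))) (i : nat)
  : 'cV[R]_((3 + 3) + (3 + 3)) :=
  if i == 0%N then charflux b 1 (node m i) (outer0 b m u) (trp m u i)
  else if i == ncells m then
    charflux b 1 (node m i) (trm m u i) (outerl b m u)
  else charflux b sigma (node m i) (trm m u i) (trp m u i).

(* In the next two definitions uh, rh are the auxiliary traces at the interior
   nodes; the boundary values are prescribed. *)
Definition u1_hat (R : realType) (m : mesh R)
    (u : broken R ((3 + 3) + (3 + 3))) (uh : nat -> 'cV[R]_(3 + 3)) (i : nat)
  : 'cV[R]_(3 + 3) :=
  if i == 0%N then 0
  else if i == ncells m then trm m (up1 u) i
  else uh i.

Definition Pir_hat (R : realType) (m : mesh R) (r : broken R (3 + 3))
    (rh : nat -> 'cV[R]_(3 + 3)) (i : nat) : 'cV[R]_((3 + 3) + (3 + 3)) :=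
  if i == 0%N then Pimx R *m trp m (rfull r) i
  else if i == ncells m then 0
  else Pimx R *m col_mx 0 (rh i).

Definition alternating_pair (R : realType) (m : mesh R)
    (u : broken R ((3 + 3) + (3 + 3))) (r : broken R (3 + 3))
    (uh rh : nat -> 'cV[R]_(3 + 3)) : Prop :=
  forall i, (1 <= i < ncells m)%N -> uh i = trm m (up1 u) i /\ rh i = trp m r i.

Definition BR1_pair (R : realType) (m : mesh R)
    (u : broken R ((3 + 3) + (3 + 3))) (r : broken R (3 + 3))
    (uh rh : nat -> 'cV[R]_(3 + 3)) : Prop :=
  forall i, (1 <= i < ncells m)%N -> uh i = avg m (up1 u) i /\ rh i = avg m r i.

Definition compatible_pair (R : realType) (m : mesh R)
    (u : broken R ((3 + 3) + (3 + 3))) (r : broken R (3 + 3))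
    (uh rh : nat -> 'cV[R]_(3 + 3)) : Prop :=
  forall i, (1 <= i < ncells m)%N ->
    dotv (rh i) (jump m (up1 u) i) + dotv (uh i) (jump m r i)
    = dotv (trm m (up1 u) i) (trm m r i) - dotv (trp m (up1 u) i) (trp m r i).

Definition qext (R : realType) (fe : R -> R -> 'cV[R]_(3 + 3)) (t x : R)
  : 'cV[R]_((3 + 3) + (3 + 3)) := col_mx (fe x t) 0.

Definition Qsrc (R : realType) (b : beam R) (fe : R -> R -> 'cV[R]_(3 + 3))
    (t : R) (u : broken R ((3 + 3) + (3 + 3))) (r : broken R (3 + 3))
    (i : nat) (y : R) : 'cV[R]_((3 + 3) + (3 + 3)) :=
  let u1 := ev (up1 u i) y in
  let u2 := ev (dn2 u i) y in
  let rt := ev (r i) y in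
  col_mx (Emx b y *m u2 + Emx b y *m rt
          - L1 u1 *m Mass b y *m u1 - L2 u2 *m Comp b y *m u2
          - L2 rt *m Comp b y *m u2)
         (- (Emx b y)^T *m u1 + (L1 u1)^T *m Comp b y *m u2)
  + qext fe t y.

Definition calA (R : realType) (b : beam R) (m : mesh R) (sigma : R)
    (u v : broken R ((3 + 3) + (3 + 3))) : R :=
  let N := ncells m in
  let h := Piu_hat b m sigma u in
  \sum_(1 <= i < N.+1) ip m i (fun y => Pimx R *m ev (u i) y) (ev (dx (v i)))
  - \sum_(1 <= i < N) dotv (h i) (jump m v i)
  - (dotv (h N) (trm m v N) - dotv (h 0%N) (trp m v 0)).

Definition calB (R : realType) (m : mesh R) (r : broken R (3 + 3))
    (rh : nat -> 'cV[R]_(3 + 3)) (v : broken R ((3 + 3) + (3 + 3))) : R :=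
  let N := ncells m in
  let h := Pir_hat m r rh in
  \sum_(1 <= i < N.+1)
     ip m i (fun y => Pimx R *m ev (rfull r i) y) (ev (dx (v i)))
  - \sum_(1 <= i < N) dotv (h i) (jump m v i)
  - (dotv (h N) (trm m v N) - dotv (h 0%N) (trp m v 0)).

Definition calC (R : realType) (m : mesh R)
    (u : broken R ((3 + 3) + (3 + 3))) (uh : nat -> 'cV[R]_(3 + 3))
    (w : broken R (3 + 3)) : R :=
  let N := ncells m in
  let h := u1_hat m u uh in
  \sum_(1 <= i < N) dotv (h i) (jump m w i)
  + (dotv (h N) (trm m w N) - dotv (h 0%N) (trp m w 0))
  - \sum_(1 <= i < N.+1) ip m i (ev (up1 u i)) (ev (dx (w i))).

Definition DG1 (R : realType) (b : beam R) (m : mesh R)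
    (fe : R -> R -> 'cV[R]_(3 + 3)) (sigma : R)
    (u : R -> broken R ((3 + 3) + (3 + 3))) (r : R -> broken R (3 + 3))
    (rh : R -> nat -> 'cV[R]_(3 + 3)) (t : R)
    (v : broken R ((3 + 3) + (3 + 3))) : Prop :=
  \sum_(1 <= i < (ncells m).+1)
     ip m i (fun y => Gam b y *m dt u t i y) (ev (v i))
  = calA b m sigma (u t) v + calB m (r t) (rh t) v
    + \sum_(1 <= i < (ncells m).+1)
        ip m i (Qsrc b fe t (u t) (r t) i) (ev (v i)).

Definition DG2 (R : realType) (b : beam R) (m : mesh R)
    (u : R -> broken R ((3 + 3) + (3 + 3))) (r : R -> broken R (3 + 3))
    (uh : R -> nat -> 'cV[R]_(3 + 3)) (t : R) (w : broken R (3 + 3)) : Prop :=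
  \sum_(1 <= i < (ncells m).+1)
     ip m i (fun y => invmx (Hmx b y) *m ev (r t i) y) (ev (w i))
  = calC m (u t) (uh t) w
    - \sum_(1 <= i < (ncells m).+1)
        ip m i (fun y => (Emx b y)^T *m ev (up1 (u t) i) y) (ev (w i))
    + \sum_(1 <= i < (ncells m).+1)
        ip m i (fun y => (L1 (ev (up1 (u t) i) y))^T *m Comp b y
                         *m ev (dn2 (u t) i) y) (ev (w i)).

Definition L2_time (R : realType) (T : R) (f : R -> R) : Prop :=
  measurable_fun `]0, T[ f /\
  (@lebesgue_measure R).-integrable `]0, T[ (fun t => (f t ^+ 2)%:E).

(* W^{1,2}(0,T), through its absolutely continuous representatives: primitives
   of L^2 functions. *)
Definition H1_time (R : realType) (T : R) (f : R -> R) : Prop :=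
  exists2 g : R -> R, L2_time T g &
    forall t, t \in `[0, T] ->
      f t = f 0 + \int[@lebesgue_measure R]_(s in `[0, t]) g s.

(* The discrete spaces are finite dimensional, so H^1(0,T;V_h) and
   L^2(0,T;W_h) are expressed through the polynomial coefficients. *)
Definition H1_Vh (R : realType) n (m : mesh R) (k : nat) (T : R)
    (u : R -> broken R n) : Prop :=
  (forall t, t \in `[0, T] -> in_Vh m k (u t)) /\
  forall i, (1 <= i <= ncells m)%N -> forall j d,
    H1_time T (fun t => (u t i j 0)`_d).

Definition L2_Vh (R : realType) n (m : mesh R) (k : nat) (T : R)
    (r : R -> broken R n) : Prop :=
  (forall t, t \in `]0, T[ -> in_Vh m k (r t)) /\
  forall i, (1 <= i <= ncells m)%N -> forall j d,
    L2_time T (fun t => (r t i j 0)`_d).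

Definition normG2 (R : realType) (b : beam R) (m : mesh R)
    (u : broken R ((3 + 3) + (3 + 3))) : R :=
  \sum_(1 <= i < (ncells m).+1)
     ip m i (fun y => Gam b y *m ev (u i) y) (ev (u i)).

(* Square of the L^2_{Gamma^-1}(Omega)^12 norm; it may be infinite. *)
Definition normGi2 (R : realType) (b : beam R)
    (g : R -> 'cV[R]_((3 + 3) + (3 + 3))) : \bar R :=
  (\int[@lebesgue_measure R]_(x in `[0%R, ell b])
     (dotv (g x) (invmx (Gam b x) *m g x))%:E)%E.

Definition L2Gi (R : realType) (b : beam R)
    (g : R -> 'cV[R]_((3 + 3) + (3 + 3))) : Prop :=
  (forall j, measurable_fun `[0, ell b] (fun x => g x j 0)) /\
  (normGi2 b g < +oo)%E.

Definition simple_L2Gi (R : realType) (b : beam R)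
    (s : R -> R -> 'cV[R]_((3 + 3) + (3 + 3))) : Prop :=
  exists (N : nat) (D : 'I_N -> set (measurableTypeR R))
         (g : 'I_N -> R -> 'cV[R]_((3 + 3) + (3 + 3))),
    [/\ forall l, measurable (D l),
        forall l, L2Gi b (g l) &
        forall t x, s t x = \sum_l (\1_(D l) t : R) *: g l x].

(* L^2(0,T;L^2_{Gamma^-1}(Omega)^12) in the sense of Bochner: q is an almost
   everywhere limit, in the norm of the target space, of simple functions, and
   its norm is square integrable in time. *)
Definition L2_L2Gi (R : realType) (b : beam R) (T : R)
    (q : R -> R -> 'cV[R]_((3 + 3) + (3 + 3))) : Prop :=
  [/\ {ae @lebesgue_measure R, forall t, t \in `]0, T[ -> L2Gi b (q t)},
      exists s : nat -> R -> R -> 'cV[R]_((3 + 3) + (3 + 3)),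
        (forall n, simple_L2Gi b (s n)) /\
        {ae @lebesgue_measure R, forall t, t \in `]0, T[ ->
           normGi2 b (fun x => s n t x - q t x) @[n --> \oo] --> 0%E} &
      (@lebesgue_measure R).-integrable `]0, T[ (fun t => normGi2 b (q t))].

Definition jump_diss (R : realType) (b : beam R) (m : mesh R) (sigma : R)
    (u : broken R ((3 + 3) + (3 + 3))) : R :=
  \sum_(1 <= i < ncells m)
    dotv ((sigma / 2) *: (Gam b (node m i) *m absmx (Amx b (node m i))
                          *m jump m u i))
         (jump m u i).

Definition r_diss (R : realType) (b : beam R) (m : mesh R)
    (r : broken R (3 + 3)) : R :=
  \sum_(1 <= i < (ncells m).+1)
     ip m i (fun y => invmx (Hmx b y) *m ev (r i) y) (ev (r i)).

Definition bdry_diss (R : realType) (b : beam R) (m : mesh R)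
    (u : broken R ((3 + 3) + (3 + 3))) : R :=
  dotv (trp m (up1 u) 0) (S0 b *m trp m (up1 u) 0)
  + dotv (trm m (dn2 u) (ncells m)) (Sell b *m trm m (dn2 u) (ncells m)).

(* Main.v *)
(* Testing (DG1) with u_h and (DG2) with r_h and adding, the source term only
   leaves (u_h, q_ext): the quadratic terms cancel because L1(c)^T c = 0 and
   L2(a)^T c = L1(c) a.  After integration by parts on each cell the interface
   terms telescope to the jumps of - u_1 . u_2 and - u_1 . r, which the central
   part of the flux and the compatible pair of auxiliary traces cancel.  At the
   boundary one uses Gamma |A| = diag(S_0, S_ell), with S_0 S_ell = 1, obtained
   by comparing two diagonalizable square roots of A^2 with nonnegative
   spectrum.  The coefficients of u_h are primitives of integrable functions, a
   class stable under products (Fubini on a triangle), so the energy E is a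
   primitive too and is differentiable almost everywhere.  Young's inequality
   2 (u_h, q_ext) <= E + |q_ext|^2 and integration of d/dt (exp(- t) E) give the
   estimate. *)
Require Import Defs.
From mathcomp Require Import all_boot all_order all_algebra.
From mathcomp Require Import complex.
From mathcomp Require Import all_classical all_reals all_analysis.
From mathcomp Require Import measurable_realfun ring lra.

Set Implicit Arguments.
Unset Strict Implicit.
Unset Printing Implicit Defensive.

Import Order.TTheory GRing.Theory Num.Theory.
Import numFieldNormedType.Exports.

Local Open Scope classical_set_scope.
Local Open Scope ring_scope.

(** * Symmetric positive definite matrices and the characteristic impedances *)

(** [A] has eigenvalues of both signs, so |A| is reached through A^2 = diag(M^-1 C^-1, C^-1 M^-1),
    which diag(C^(1/2), C^(-1/2)) conjugates to two copies of Psi; this is where the square roots in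
    S_0 and S_ell come from. No derivative of a material coefficient ever arises: Pi is constant, so
    integration by parts only meets polynomials, and the coefficients enter by continuity, symmetry
    and positivity. Nor is there any differentiation under the integral sign. Expanded in monomials,
    the energy is a quadratic form, with weights constant in time, in the finitely many polynomial
    coefficients of u_h, so the product rule for primitives is enough. The constant e^T comes from
    exp(-T) <= exp(-t) <= 1: the lower bound is spent on the dissipation, the upper one on the load.
    The integrability in time of the dissipation is obtained on the way, by domination. *)

(** Seen as a complex matrix, [A] is Hermitian, hence unitarily diagonalizable with real
    eigenvalues. Real matrices that are similar over the complex numbers are similar over the reals,
    which yields a real [P]. This [P] is only known to be invertible, not orthogonal. *)
Lemma sym_diagonalizable (R : realType) n (A : 'M[R]_n) : A^T = A ->
  exists (P : 'M[R]_n) (lam : 'rV[R]_n),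
    P \in unitmx /\ A = invmx P *m diag_mx lam *m P.
Proof.
move=> symA.
pose f := real_complex R.
pose B : 'M[R[i]]_n := map_mx f A.
have realB : B \is a mxOver Num.real.
  by apply/mxOverP => i j; rewrite mxE complex_real.
have hermB : B \is hermsymmx.
  apply: realsym_hermsym => //.
  apply/is_hermitianmxP; rewrite expr0 scale1r map_mx_id//.
  by rewrite /B -{1}symA; apply/matrixP => i j; rewrite !mxE.
have /orthomx_spectralP := hermitian_normalmx hermB.
set P0 := spectralmx _; set d := spectral_diag _ => BE.
have reald : d \is a mxOver Num.real by exact: hermitian_spectral_diag_real.
have P0u : P0 \in unitmx by exact: spectral_unit.
clearbody P0 d.
pose lam : 'rV[R]_n := map_mx (@complex.Re R) d.
have dE : d = map_mx f lam.
  apply/matrixP => i j; rewrite !mxE.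
  by move/mxOverP: reald => /(_ i j)/complex_realP[x ->].
have diagE : diag_mx d = map_mx f (diag_mx lam).
  by rewrite dE map_diag_mx.
have realD : diag_mx d \is a mxOver Num.real.
  by rewrite diagE; apply/mxOverP => i j; rewrite mxE complex_real.
have sim : similar_in unitmx B (diag_mx d).
  exists P0; first exact: P0u.
  apply/(similarP P0u).
  by rewrite {1}BE !mulmxA mulmxV ?mul1mx.
have [Q /andP[/= realQ Qu] /(similarP Qu) QE] := real_similar sim realB realD.
pose P : 'M[R]_n := map_mx (@complex.Re R) Q.
have QP : Q = map_mx f P.
  apply/matrixP => i j; rewrite !mxE.
  by move/mxOverP: realQ => /(_ i j)/complex_realP[x ->].
exists P, lam.
have Pu : P \in unitmx by move: Qu; rewrite QP map_unitmx.
split => //.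
have : P *m A = diag_mx lam *m P.
  apply: (@map_mx_inj _ _ f); rewrite !map_mxM /= -diagE -QP; exact: QE.
by rewrite -mulmxA => <-; rewrite mulKmx.
Qed.

Lemma dotvE (R : realType) n (a b : 'cV[R]_n) :
  dotv a b = \sum_i a i 0 * b i 0.
Proof. by rewrite /dotv mxE; apply: eq_bigr => i _; rewrite mxE. Qed.

Lemma dotvC (R : realType) n (a b : 'cV[R]_n) : dotv a b = dotv b a.
Proof. by rewrite !dotvE; apply: eq_bigr => i _; rewrite mulrC. Qed.

Lemma dotv0l (R : realType) n (b : 'cV[R]_n) : dotv 0 b = 0.
Proof. by rewrite /dotv trmx0 mul0mx mxE. Qed.

Lemma dotvDr (R : realType) n (a b c : 'cV[R]_n) :
  dotv a (b + c) = dotv a b + dotv a c.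
Proof. by rewrite /dotv mulmxDr mxE. Qed.

Lemma dotvDl (R : realType) n (a b c : 'cV[R]_n) :
  dotv (a + b) c = dotv a c + dotv b c.
Proof. by rewrite dotvC dotvDr !(dotvC c). Qed.

Lemma dotvNr (R : realType) n (a b : 'cV[R]_n) : dotv a (- b) = - dotv a b.
Proof. by rewrite /dotv mulmxN mxE. Qed.

Lemma dotvNl (R : realType) n (a b : 'cV[R]_n) : dotv (- a) b = - dotv a b.
Proof. by rewrite dotvC dotvNr dotvC. Qed.

Lemma dotvZr (R : realType) n k (a b : 'cV[R]_n) :
  dotv a (k *: b) = k * dotv a b.
Proof. by rewrite /dotv -scalemxAr mxE. Qed.

Lemma dotvZl (R : realType) n k (a b : 'cV[R]_n) :
  dotv (k *: a) b = k * dotv a b.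
Proof. by rewrite dotvC dotvZr dotvC. Qed.

Lemma dotv_mulmx (R : realType) m n (A : 'M[R]_(m, n)) a b :
  dotv a (A *m b) = dotv (A^T *m a) b.
Proof. by rewrite /dotv trmx_mul trmxK mulmxA. Qed.

Lemma dotv_col (R : realType) m n (a c : 'cV[R]_m) (b d : 'cV[R]_n) :
  dotv (col_mx a b) (col_mx c d) = dotv a c + dotv b d.
Proof. by rewrite /dotv tr_col_mx mul_row_col mxE. Qed.

Lemma dotvv_ge0 (R : realType) n (a : 'cV[R]_n) : 0 <= dotv a a.
Proof. by rewrite dotvE sumr_ge0// => i _; rewrite -expr2 sqr_ge0. Qed.

Lemma dotvv_gt0 (R : realType) n (a : 'cV[R]_n) : a != 0 -> 0 < dotv a a.
Proof.
rewrite lt_def dotvv_ge0 andbT; apply: contra_neq => /eqP; rewrite dotvE.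
rewrite psumr_eq0 => [/allP a0|i _]; last by rewrite -expr2 sqr_ge0.
apply/matrixP => i j; rewrite ord1 mxE.
by have := a0 i (mem_index_enum i); rewrite mulf_eq0 orbb => /eqP.
Qed.

Lemma spd_unitmx (R : realType) n (A : 'M[R]_n) : spd A -> A \in unitmx.
Proof.
move=> [symA posA]; rewrite unitmxE unitfE; apply/negP => /det0P[v v0 vA].
have := posA v^T; rewrite trmx_eq0 v0 => /(_ isT).
by rewrite dotv_mulmx symA -(trmxK (A *m _)) trmx_mul trmxK symA vA trmx0
  dotv0l ltxx.
Qed.

Lemma spd_ge0 (R : realType) n (A : 'M[R]_n) z :
  spd A -> 0 <= dotv z (A *m z).
Proof.
move=> [_ posA]; have [->|/posA/ltW//] := eqVneq z 0.
by rewrite dotv0l.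
Qed.

Lemma spd_congr (R : realType) n (S A : 'M[R]_n) :
  S^T = S -> S \in unitmx -> spd A -> spd (S *m A *m S).
Proof.
move=> symS Su [symA posA]; split; first by rewrite !trmx_mul symS symA mulmxA.
move=> z z0; rewrite -!mulmxA dotv_mulmx symS posA//.
by apply: contra_neq z0 => Sz; rewrite -(mulKmx Su z) Sz mulmx0.
Qed.

Lemma spd_inv (R : realType) n (A : 'M[R]_n) : spd A -> spd (invmx A).
Proof.
move=> spdA; have Au := spd_unitmx spdA.
have symV : (invmx A)^T = invmx A by rewrite trmx_inv spdA.1.
have -> : invmx A = invmx A *m A *m invmx A by rewrite mulVmx// mul1mx.
by apply: spd_congr; rewrite ?unitmx_inv.
Qed.

Lemma spd1 (R : realType) n : spd (1%:M : 'M[R]_n).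
Proof. by split=> [|z z0]; rewrite ?trmx1// mul1mx dotvv_gt0. Qed.

Lemma spd_sqr (R : realType) n (S : 'M[R]_n) :
  S^T = S -> S \in unitmx -> spd (S *m S).
Proof.
by move=> sS Su; rewrite -[X in X *m _](mulmx1 S); exact/spd_congr/spd1.
Qed.

(* Entrywise, X a = b X says that X i j vanishes unless a j = b i. *)
Lemma diag_mx_intertwine (R : realType) m n (X : 'M[R]_(m, n)) a b
    (f : R -> R) : X *m diag_mx a = diag_mx b *m X ->
  X *m diag_mx (map_mx f a) = diag_mx (map_mx f b) *m X.
Proof.
rewrite !mul_mx_diag !mul_diag_mx => /matrixP e; apply/matrixP => i j.
have := e i j; rewrite !mxE (mulrC (b 0 i)) (mulrC (f _)).
by have [->|X0 /(mulfI X0)->] := eqVneq (X i j) 0; rewrite ?mul0r.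
Qed.

(** Functional calculus does not depend on the diagonalization: the change of basis between the two
    intertwines the eigenvalues, hence also their images under [f]. Used with the absolute value for
    [absmx], and with the square root to compare two diagonalizations of A^2. *)
Lemma diag_similar_map (R : realType) n (T T' : 'M[R]_n) a b (f : R -> R) :
  T \in unitmx -> T' \in unitmx ->
  T *m diag_mx a *m invmx T = T' *m diag_mx b *m invmx T' ->
  T *m diag_mx (map_mx f a) *m invmx T
  = T' *m diag_mx (map_mx f b) *m invmx T'.
Proof.
move=> Tu Tu' e; have : invmx T' *m T *m diag_mx a = diag_mx b *m
  (invmx T' *m T).
  move/(congr1 (fun X => invmx T' *m X *m T)): e.
  by rewrite !mulmxA mulmxKV// mulVmx// mul1mx.
move/(diag_mx_intertwine f)/(congr1 (fun X => T' *m X *m invmx T)).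
by rewrite !mulmxA mulmxV// mul1mx mulmxK.
Qed.

Lemma mulmx_diag_similar (R : realType) n (T : 'M[R]_n) a b :
  T \in unitmx ->
  (T *m diag_mx a *m invmx T) *m (T *m diag_mx b *m invmx T)
  = T *m diag_mx (\row_i (a 0 i * b 0 i)) *m invmx T.
Proof.
move=> Tu; rewrite !mulmxA mulmxKV// -(mulmxA T); congr (_ *m _ *m _).
by rewrite mulmx_diag.
Qed.

(** The root is [S Num.sqrt], where [S f] applies [f] to the eigenvalues. Since [P] need not be
    orthogonal, the symmetry of [S f] requires an argument. *)
Lemma spd_sqrt_exists (R : realType) n (A : 'M[R]_n) : spd A ->
  exists P : 'M[R]_n, spd P /\ P *m P = A.
Proof.
move=> [symA posA]; have [P [lam [Pu AE]]] := sym_diagonalizable symA.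
pose S f := invmx P *m diag_mx (map_mx f lam) *m P.
have lam_gt0 i : 0 < lam 0 i.
  pose z : 'cV[R]_n := invmx P *m delta_mx i 0.
  have z0 : z != 0.
    apply/negP => /eqP /(congr1 (mulmx P)); rewrite mulKVmx// mulmx0.
    by move/matrixP/(_ i 0); rewrite !mxE !eqxx => /eqP; rewrite oner_eq0.
  have Az : A *m z = lam 0 i *: z.
    rewrite AE /z mulmxA mulmxK// -mulmxA mul_diag_mx scalemxAr; congr (_ *m _).
    apply/matrixP => a b; rewrite !mxE ord1.
    by have [->|_] := eqVneq a i; rewrite ?mulr0.
  by have := posA _ z0; rewrite Az dotvZr pmulr_lgt0 ?dotvv_gt0.
have S_sym f : (S f)^T = S f.
  (* Symmetry of [A] means that the Gram matrix [P *m P^T] commutes with the eigenvalues, hence with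
     any function of them. *)
  have e : (P *m P^T) *m diag_mx lam = diag_mx lam *m (P *m P^T).
    move: symA; rewrite AE !trmx_mul tr_diag_mx.
    move/(congr1 (fun X => P *m X *m P^T)).
    rewrite trmx_inv !mulmxA mulmxV// mul1mx mulmxKV//;
      last by rewrite unitmx_tr.
  move/(diag_mx_intertwine f): e =>
    /(congr1 (fun X => invmx P *m X *m (invmx P)^T)).
  rewrite /S !trmx_mul tr_diag_mx trmx_inv !mulmxA mulVmx// mul1mx => ->.
  by rewrite mulmxK ?unitmx_tr.
have S_mul f g : S f *m S g = S (fun x => f x * g x).
  rewrite /S !mulmxA mulmxK// -(mulmxA (invmx P)) mulmx_diag.
  congr (_ *m diag_mx _ *m _).
  by apply/matrixP => i j; rewrite !mxE ord1.
have S_unit f : (forall x, 0 < x -> 0 < f x) -> S f \in unitmx.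
  move=> f0; rewrite /S !unitmx_mul unitmx_inv Pu andbT /= unitmxE det_diag.
  rewrite unitfE prodf_seq_neq0; apply/allP => i _ /=.
  by rewrite mxE gt_eqF// f0.
have S_eq f g : (forall x, 0 < x -> f x = g x) -> S f = S g.
  move=> fg; rewrite /S; congr (_ *m diag_mx _ *m _).
  by apply/matrixP => i j; rewrite !mxE ord1 fg.
exists (S Num.sqrt); split.
  (* Positivity: the square root is the square of the fourth root, which is symmetric and
     invertible, so [spd_sqr] applies. *)
  have -> : S Num.sqrt = S (Num.sqrt \o Num.sqrt) *m S (Num.sqrt \o Num.sqrt).
    rewrite S_mul; apply: S_eq => x x0 /=.
    by rewrite -expr2 sqr_sqrtr// sqrtr_ge0.
  apply: spd_sqr => //; apply: S_unit => x x0 /=.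
  by rewrite !sqrtr_gt0.
rewrite S_mul (S_eq _ id).
  by rewrite /S map_mx_id.
by move=> x x0; rewrite -expr2 sqr_sqrtr// ltW.
Qed.

Lemma sqrtmxP (R : realType) n (A : 'M[R]_n) : spd A ->
  spd (sqrtmx A) /\ sqrtmx A *m sqrtmx A = A.
Proof. by move=> spdA; exact: (xgetPex 0 (spd_sqrt_exists spdA)). Qed.

Lemma absmxE (R : realType) n (T : 'M[R]_n) (lam : 'rV[R]_n) : T \in unitmx ->
  absmx (T *m diag_mx lam *m invmx T)
  = T *m diag_mx (map_mx (fun a => `|a|) lam) *m invmx T.
Proof.
move=> Tu; rewrite /absmx; set U := [set B | _].
have /(xgetPex 0)[T' [lam' [Tu' e ->]]] : exists B, U B.
  by eexists; exists T, lam.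
by apply/esym/diag_similar_map.
Qed.

Lemma invmx_mul (R : realType) n (A B : 'M[R]_n) :
  A \in unitmx -> B \in unitmx -> invmx (A *m B) = invmx B *m invmx A.
Proof.
move=> Au Bu; have ABu : A *m B \in unitmx by rewrite unitmx_mul Au.
rewrite -[RHS]mulmx1 -(mulmxV ABu) !mulmxA.
by rewrite mulmxKV// mulVmx// mul1mx.
Qed.

(** Conjugation by the square root g of [G] turns G^-1 P into the symmetric matrix g^-1 P g^-1. This
    provides the diagonalization of [Amx] that [absmx] presupposes. *)
Lemma spd_mul_sym_diagonalizable (R : realType) n (G P : 'M[R]_n) :
  spd G -> P^T = P -> exists (T : 'M[R]_n) (lam : 'rV[R]_n),
    T \in unitmx /\ invmx G *m P = T *m diag_mx lam *m invmx T.
Proof.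
move=> spdG symP; have [spdg gg] := sqrtmxP spdG; set g := sqrtmx G in spdg gg.
have gu := spd_unitmx spdg.
have [|Q [lam [Qu e]]] := @sym_diagonalizable _ _ (invmx g *m P *m invmx g).
  by rewrite !trmx_mul symP (spd_inv spdg).1 mulmxA.
exists (invmx g *m invmx Q), lam; split;
  first by rewrite unitmx_mul !unitmx_inv gu.
rewrite invmx_mul ?unitmx_inv// !invmxK.
move/(congr1 (fun X => invmx g *m X *m g)): e; rewrite !mulmxA mulmxKV// => <-.
by rewrite -gg invmx_mul.
Qed.

Lemma spd_Gam (R : realType) (b : beam R) x :
  spd (Mass b x) -> spd (Comp b x) -> spd (Gam b x).
Proof.
move=> spdM spdC; split; first by rewrite /Gam tr_block_mx !trmx0 spdM.1 spdC.1.
move=> z; rewrite -[z]vsubmxK /Gam mul_block_col !mul0mx addr0 add0r dotv_col.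
rewrite col_mx_eq0 negb_and => /orP[z0|z0].
  by rewrite ltr_wpDr ?spd_ge0// spdM.2.
by rewrite ltr_wpDl ?spd_ge0// spdC.2.
Qed.

(** * The block form of Gamma |A| *)

Section characteristic_impedance.
Variables (R : realType) (b : beam R) (x : R).
Hypotheses (spdM : spd (Mass b x)) (spdC : spd (Comp b x)).

(* The impedances at an arbitrary point: S0 b is S0_at b 0 and Sell b is
   Sell_at b (ell b). *)
Definition S0_at : 'M[R]_(3 + 3) :=
  invmx (sqrtmx (Comp b x)) *m invmx (sqrtmx (Psi b x))
  *m invmx (sqrtmx (Comp b x)).

Definition Sell_at : 'M[R]_(3 + 3) :=
  sqrtmx (Comp b x) *m sqrtmx (Psi b x) *m sqrtmx (Comp b x).

Let c := sqrtmx (Comp b x).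
Let psi := sqrtmx (Psi b x).

Let spdc : spd c. Proof. exact: (sqrtmxP spdC).1. Qed.
Let cu : c \in unitmx. Proof. exact: spd_unitmx. Qed.
Let cc : c *m c = Comp b x. Proof. exact: (sqrtmxP spdC).2. Qed.
Let Mu : Mass b x \in unitmx. Proof. exact: spd_unitmx. Qed.
Let Cu : Comp b x \in unitmx. Proof. exact: spd_unitmx. Qed.

Let spdPsi : spd (Psi b x).
Proof.
apply: spd_congr; first exact: (spd_inv spdc).1.
- by rewrite unitmx_inv.
- exact: spd_inv.
Qed.

Let spdpsi : spd psi. Proof. exact: (sqrtmxP spdPsi).1. Qed.
Let psiu : psi \in unitmx. Proof. exact: spd_unitmx. Qed.
Let psipsi : psi *m psi = invmx c *m invmx (Mass b x) *m invmx c.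
Proof. exact: (sqrtmxP spdPsi).2. Qed.

Lemma spd_S0_at : spd S0_at.
Proof.
by apply: spd_congr; rewrite ?unitmx_inv// ?(spd_inv spdc).1//; exact: spd_inv.
Qed.

Lemma spd_Sell_at : spd Sell_at.
Proof. by apply: spd_congr; rewrite ?spdc.1. Qed.

Lemma S0_at_Sell_at : S0_at *m Sell_at = 1%:M.
Proof. by rewrite /S0_at /Sell_at !mulmxA mulmxKV// mulmxKV// mulVmx. Qed.

Lemma Sell_at_S0_at : Sell_at *m S0_at = 1%:M.
Proof. by rewrite mulmx1C// S0_at_Sell_at. Qed.

(** With c = C^(1/2) and psi = Psi^(1/2), the blocks of A^2 are M^-1 C^-1 = c psi^2 c^-1 and C^-1
    M^-1 = c^-1 psi^2 c. Hence |A| = diag(c psi c^-1, c^-1 psi c), and multiplication by M = c^-1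
    psi^-2 c^-1 and C = c^2 gives the two impedances. *)
Lemma Gam_absmx :
  Gam b x *m absmx (Amx b x) = block_mx S0_at 0 0 Sell_at.
Proof.
have Gu : Gam b x \in unitmx by rewrite block_diag_mx_unit Mu.
have GV := invmx_block_diag Gu.
have symPi : (Pimx R)^T = Pimx R.
  by rewrite /Pimx tr_block_mx !trmx0 linearN/= trmx1.
have spdG : spd (Gam b x) by exact: spd_Gam.
have [T1 [lam [T1u AE]]] := spd_mul_sym_diagonalizable spdG symPi.
have [Q [d [Qu psiE]]] := sym_diagonalizable spdpsi.1.
(* An eigenbasis of A^2: one of psi (the columns of [invmx Q]), carried by c into the first block
   and by c^-1 into the second. *)
pose T2 : 'M[R]_((3 + 3) + (3 + 3)) :=
  block_mx (c *m invmx Q) 0 0 (invmx c *m invmx Q).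
have [T2u T2V] : T2 \in unitmx /\ invmx T2 = block_mx (Q *m invmx c) 0 0
  (Q *m c).
  have u : T2 \in unitmx.
    by rewrite block_diag_mx_unit !unitmx_mul !unitmx_inv cu Qu.
  by rewrite u invmx_block_diag// !invmx_mul ?unitmx_inv// !invmxK.
have d_ge0 i : 0 <= d 0 i.
  pose z : 'cV[R]_(3 + 3) := invmx Q *m delta_mx i 0.
  have z0 : z != 0.
    apply/negP => /eqP /(congr1 (mulmx Q)); rewrite mulKVmx// mulmx0.
    by move/matrixP/(_ i 0); rewrite !mxE !eqxx => /eqP; rewrite oner_eq0.
  have pz : psi *m z = d 0 i *: z.
    rewrite psiE /z mulmxA mulmxK// -mulmxA mul_diag_mx scalemxAr;
      congr (_ *m _).
    apply/matrixP => k l; rewrite !mxE ord1.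
    by have [->|_] := eqVneq k i; rewrite ?mulr0.
  by have := spdpsi.2 _ z0; rewrite pz dotvZr pmulr_lgt0 ?dotvv_gt0// => /ltW.
have T2D (e : 'rV[R]_(3 + 3)) : T2 *m diag_mx (row_mx e e) *m invmx T2 =
    block_mx (c *m (invmx Q *m diag_mx e *m Q) *m invmx c) 0 0
             (invmx c *m (invmx Q *m diag_mx e *m Q) *m c).
  rewrite T2V diag_mx_row !mulmx_block !(mul0mx, mulmx0, addr0, add0r).
  by rewrite !mulmxA.
have AA : T1 *m diag_mx (\row_i (lam 0 i * lam 0 i)) *m invmx T1
          = T2 *m diag_mx (row_mx (\row_i (d 0 i * d 0 i))
            (\row_i (d 0 i * d 0 i))) *m invmx T2.
  rewrite -mulmx_diag_similar// -AE T2D.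
  have -> : invmx Q *m diag_mx (\row_i (d 0 i * d 0 i)) *m Q = psi *m psi.
    by rewrite psiE !mulmxA mulmxK// -[in RHS](mulmxA (invmx Q)) mulmx_diag.
  rewrite psipsi /Gam GV /Pimx !mulmx_block !(mul0mx, mulmx0, addr0, add0r).
  rewrite !(mulmxN, mulmx1, mulNmx, opprK).
  rewrite !mulmxA mulmxV// mul1mx mulmxKV//.
  by rewrite -[X in _ = block_mx X _ _ _]mulmxA -invmx_mul// cc.
(* Roots of the eigenvalues of A^2: on one side lam^2 becomes |lam|, on the other d^2 becomes d
   because d >= 0. *)
move/(diag_similar_map Num.sqrt T1u T2u): AA.
have -> : map_mx Num.sqrt (\row_i (lam 0 i * lam 0 i)) = map_mx (fun a => `|a|)
  lam.
  by apply/matrixP => i j; rewrite !mxE ord1 -expr2 sqrtr_sqr.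
have -> : map_mx Num.sqrt (row_mx (\row_i (d 0 i * d 0 i))
  (\row_i (d 0 i * d 0 i))) = row_mx d d.
  rewrite map_row_mx; congr (row_mx _ _); apply/matrixP => i j;
  by rewrite !mxE ord1 -expr2 sqrtr_sqr ger0_norm.
rewrite -absmxE// -AE => ->; rewrite T2D -psiE /Gam mulmx_block.
rewrite !(mul0mx, mulmx0, addr0, add0r); congr (block_mx _ 0 0 _).
  have -> : Mass b x = invmx c *m invmx (psi *m psi) *m invmx c.
    rewrite psipsi !invmx_mul ?unitmx_mul ?unitmx_inv ?cu// !invmxK.
    by rewrite !mulmxA mulVmx// mul1mx mulmxK.
  by rewrite /S0_at invmx_mul// !mulmxA mulmxKV// mulmxKV.
by rewrite -cc !mulmxA mulmxK.
Qed.

End characteristic_impedance.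

(** * Integrable functions, continuity on a subspace and primitives *)

Section real_integrable.
Context d (U : measurableType d) (R : realType)
  (nu : {measure set U -> \bar R}).
Variables (D : set U) (mD : measurable D).
Implicit Types f g : U -> R.

Lemma integrable_measurable f : nu.-integrable D (EFin \o f) ->
  measurable_fun D f.
Proof. by move/(measurable_int nu)/measurable_EFinP. Qed.

Lemma eq_integrableR f g : {in D, f =1 g} ->
  nu.-integrable D (EFin \o f) -> nu.-integrable D (EFin \o g).
Proof. by move=> fg; apply: eq_integrable => // x /fg /= ->. Qed.

Lemma integrableRD f g : nu.-integrable D (EFin \o f) ->
  nu.-integrable D (EFin \o g) ->
    nu.-integrable D (EFin \o (fun x => f x + g x)).
Proof. exact: integrableD. Qed.

Lemma integrableRB f g : nu.-integrable D (EFin \o f) ->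
  nu.-integrable D (EFin \o g) ->
    nu.-integrable D (EFin \o (fun x => f x - g x)).
Proof. exact: integrableB. Qed.

Lemma integrableRZ k f : nu.-integrable D (EFin \o f) ->
  nu.-integrable D (EFin \o (fun x => k * f x)).
Proof. exact: integrableZl. Qed.

Lemma integrableRM f g : measurable_fun D f -> [bounded f x | x in D] ->
  nu.-integrable D (EFin \o g) ->
    nu.-integrable D (EFin \o (fun x => f x * g x)).
Proof. exact: integrableMr. Qed.

Lemma integrableR_sum I (s : seq I) (P : pred I) (h : I -> U -> R) :
  (forall i, P i -> nu.-integrable D (EFin \o h i)) ->
  nu.-integrable D (EFin \o (fun x => \sum_(i <- s | P i) h i x)).
Proof.
move=> ih; have := integrable_sum mD s ih; apply: eq_integrable => // x _.
by rewrite /= sumEFin.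
Qed.

Lemma Rintegral_sum I (s : seq I) (P : pred I) (h : I -> U -> R) :
  (forall i, P i -> nu.-integrable D (EFin \o h i)) ->
  \int[nu]_(x in D) (\sum_(i <- s | P i) h i x)
  = \sum_(i <- s | P i) \int[nu]_(x in D) h i x.
Proof.
move=> ih; elim: s => [|i s IH].
  rewrite big_nil; under eq_Rintegral do rewrite big_nil.
  by rewrite Rintegral_cst// mul0r.
rewrite big_cons; under eq_Rintegral do rewrite big_cons.
case: ifP => // Pi; rewrite RintegralD ?IH//; first exact: ih.
exact: integrableR_sum.
Qed.

End real_integrable.

Section within_continuous_real.
Variables (U : topologicalType) (R : realType) (A : set U).
Implicit Types f g : U -> R.

Lemma wcont_cst (c : R) : {within A, continuous (fun _ : U => c)}.
Proof. by move=> x; exact: cvg_cst. Qed.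

Lemma wcontD f g : {within A, continuous f} -> {within A, continuous g} ->
  {within A, continuous (fun x => f x + g x)}.
Proof. by move=> cf cg x; apply: cvgD; [exact: cf|exact: cg]. Qed.

Lemma wcontN f : {within A, continuous f} ->
  {within A, continuous (fun x => - f x)}.
Proof. by move=> cf x; apply: cvgN; exact: cf. Qed.

Lemma wcontM f g : {within A, continuous f} -> {within A, continuous g} ->
  {within A, continuous (fun x => f x * g x)}.
Proof. by move=> cf cg x; apply: cvgM; [exact: cf|exact: cg]. Qed.

Lemma wcont_sum I (s : seq I) (P : pred I) (f : I -> U -> R) :
  (forall i, P i -> {within A, continuous (f i)}) ->
  {within A, continuous (fun x => \sum_(i <- s | P i) f i x)}.
Proof.
move=> cf; elim: s => [|i s ih].
  by under eq_fun do rewrite big_nil; exact: wcont_cst.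
under eq_fun do rewrite big_cons.
by case Pi: (P i) => //; apply: wcontD => //; exact: cf.
Qed.

Lemma wcont_prod I (s : seq I) (P : pred I) (f : I -> U -> R) :
  (forall i, P i -> {within A, continuous (f i)}) ->
  {within A, continuous (fun x => \prod_(i <- s | P i) f i x)}.
Proof.
move=> cf; elim: s => [|i s ih].
  by under eq_fun do rewrite big_nil; exact: wcont_cst.
under eq_fun do rewrite big_cons.
by case Pi: (P i) => //; apply: wcontM => //; exact: cf.
Qed.

Lemma wcont_eq f g : {in A, f =1 g} -> {within A, continuous f} ->
  {within A, continuous g}.
Proof. exact: subspace_eq_continuous. Qed.

(* Inversion is only continuous off 0, and a point outside A may be a zero; on
   the subspace topology such points are isolated. *)
Lemma wcontV f : (forall x, A x -> f x != 0) -> {within A, continuous f} ->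
  {within A, continuous (fun x => (f x)^-1)}.
Proof.
move=> f0 cf.
apply: (@wcont_eq (fun x => (if x \in A then f x else 1)^-1)).
  by move=> x xA; rewrite ifT.
move=> x; apply: cvgV; first by case: ifPn => [/set_mem/f0//|_];
  exact: oner_neq0.
have : {within A, continuous (fun x => if x \in A then f x else 1)}.
  by apply: wcont_eq cf => y yA; rewrite ifT.
exact.
Qed.

End within_continuous_real.

(** * Primitives of integrable functions: product rule and almost everywhere derivative *)

Section primitives.
Variable R : realType.
Local Notation mu := (@lebesgue_measure R).
Implicit Types (f g : R -> R) (T : R).

Lemma integrable_itv_closure f a b :
  mu.-integrable `]a, b[ (EFin \o f) -> mu.-integrable `[a, b] (EFin \o f).
Proof.
move=> /integrableP[mf foo].
have mf1 : measurable_fun `]a, b[ f by exact/measurable_EFinP.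
apply/integrableP; split.
  by apply/measurable_EFinP; apply: measurable_fun_itv_cc mf1.
rewrite (integral_itv_bndoo (f := fun x => `|(EFin \o f) x|%E)) //.
exact: measurableT_comp.
Qed.

Lemma L2_time_integrable T g : L2_time T g ->
  mu.-integrable `[0, T] (EFin \o g).
Proof.
move=> [mg ig]; apply: integrable_itv_closure.
(* On a bounded interval 1 + g^2 is integrable and dominates |g|. *)
have i1 : mu.-integrable `]0, T[ (cst 1%E).
  have i1 : mu.-integrable `[0, T] (EFin \o (cst 1 : R -> R)).
    apply: continuous_compact_integrable; first exact: segment_compact.
    by apply: continuous_subspaceT => x; exact: cst_continuous.
  by apply: integrableS i1 => //; exact: subset_itv_oo_cc.
apply: le_integrable (integrableD _ i1 ig) => //.
- exact/measurable_EFinP.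
- move=> x _ /=; rewrite lee_fin [leRHS]ger0_norm; last first.
    by rewrite addr_ge0// sqr_ge0.
  rewrite -[X in _ <= _ + X]real_normK ?num_real//.
  by have := sqr_ge0 (`|g x| - 1); have := normr_ge0 (g x); nra.
Qed.

(** Fubini for f(s) g(r) on the triangle r < s inside the square of side t. The strict inequality
    puts s outside the inner domain of r; adding it back changes nothing, a point being null. *)
Lemma Rintegral_triangle t f g : 0 <= t ->
  mu.-integrable `[0, t] (EFin \o f) -> mu.-integrable `[0, t] (EFin \o g) ->
  \int[mu]_(s in `[0, t]) (f s * \int[mu]_(r in `[0, s]) g r)
  = \int[mu]_(r in `[0, t]) (g r * \int[mu]_(s in `]r, t]) f s).
Proof.
move=> t0 intf intg.
pose D := `[0, t]%classic : set (measurableTypeR R).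
have mD : measurable D by exact: measurable_itv.
pose f1 := f \_ D; pose g1 := g \_ D.
have mf1 : measurable_fun setT f1.
  by apply/(measurable_restrictT f mD); exact: integrable_measurable intf.
have mg1 : measurable_fun setT g1.
  by apply/(measurable_restrictT g mD); exact: integrable_measurable intg.
have intf1 : mu.-integrable setT (EFin \o f1).
  by rewrite -restrict_EFin;
    apply: (@integrable_mkcond _ (measurableTypeR R) R mu D (EFin \o f) mD).1
      intf.
have intg1 : mu.-integrable setT (EFin \o g1).
  by rewrite -restrict_EFin;
    apply: (@integrable_mkcond _ (measurableTypeR R) R mu D (EFin \o g) mD).1
      intg.
pose h (z : R * R) : R := if z.2 < z.1 then f1 z.1 * g1 z.2 else 0.
have mfg : measurable_fun setT (fun z : R * R => f1 z.1 * g1 z.2).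
  apply: measurable_funM.
  - exact: (measurableT_comp mf1).
  - exact: (measurableT_comp mg1).
have mh : measurable_fun setT h.
  by apply: measurable_fun_ifT => //; exact: measurable_fun_ltr.
have ih : (mu \x mu)%E.-integrable setT (EFin \o h).
  (* The tensor product is integrable since its iterated absolute integral is the product of two
     finite ones; it dominates [h]. *)
  have : (mu \x mu)%E.-integrable setT
    (EFin \o (fun z : R * R => f1 z.1 * g1 z.2)).
    apply/integrable12ltyP; first exact/measurable_EFinP.
    have absg := integrable_abse intg1; have absf := integrable_abse intf1.
    set K := (\int[mu]_y `|(g1 y)%:E|)%E.
    have Kfin : K \is a fin_num by exact: integrable_fin_num absg.
    under eq_integral => x _.
      under eq_integral => y _ do rewrite /= normrM EFinM.
      rewrite integralZl//.
      rewrite -[X in (_ * X)%E](fineK Kfin).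
      over.
    rewrite integralZr//.
    rewrite lte_mul_pinfty ?integral_ge0//; last by rewrite ltry.
    exact: integrable_fin_num absf.
  apply: le_integrable => //; first exact/measurable_EFinP.
  move=> z _ /=; rewrite lee_fin /h; case: ifP => _ //.
  by rewrite normr0.
have inner1 s : (\int[mu]_r (h (s, r))%:E
    = (((fun s => f s * \int[mu]_(r in `[0, s]) g r) \_ D) s)%:E)%E.
  rewrite [in RHS]patchE; case: ifPn => [|sD]; last first.
    rewrite integral0_eq// => r _; rewrite /h /= /f1 patchE (negbTE sD) mul0r.
    by case: ifP.
  rewrite inE /D /= in_itv /= => /andP[s0 st].
  have sD : s \in D by rewrite inE /D /= in_itv /= s0.
  have intgs : mu.-integrable `[0, s[ (EFin \o g).
    apply: integrableS intg => // r /=; rewrite !in_itv /= => /andP[-> /ltW rs].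
    exact: le_trans st.
  transitivity (\int[mu]_(r in `[0%R, s[) ((f s)%:E * (g r)%:E))%E.
    rewrite [RHS]integral_mkcond; apply: eq_integral => r _.
    rewrite /h /= [RHS]patchE mem_setE in_itv /= andbC.
    have [rs|rs] /= := ltP r s; last by [].
    rewrite /f1 /g1 !patchE sD mem_setE in_itv /=.
    rewrite (le_trans (ltW rs) st) andbT.
    by case: ifP => _; rewrite ?mulr0// EFinM.
  rewrite integralZl// -(Rintegral_itv_bndo_bndc intgs) EFinM /Rintegral.
  by rewrite fineK//; exact: integrable_fin_num intgs.
have inner2 r : (\int[mu]_s (h (s, r))%:E
    = (((fun r => g r * \int[mu]_(s in `]r, t]) f s) \_ D) r)%:E)%E.
  rewrite [in RHS]patchE; case: ifPn => [|rD]; last first.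
    rewrite integral0_eq// => s _; rewrite /h /= /g1 patchE (negbTE rD) mulr0.
    by case: ifP.
  rewrite inE /D /= in_itv /= => /andP[r0 rt].
  have rD : r \in D by rewrite inE /D /= in_itv /= r0.
  have intfr : mu.-integrable `]r, t] (EFin \o f).
    apply: integrableS intf => // s /=; rewrite !in_itv /= => /andP[/ltW rs ->].
    by rewrite andbT (le_trans r0).
  transitivity (\int[mu]_(s in `]r, t]) ((g r)%:E * (f s)%:E))%E.
    rewrite [RHS]integral_mkcond; apply: eq_integral => s _.
    rewrite /h /= [RHS]patchE mem_setE in_itv /=.
    have [rs|rs] /= := ltP r s; last by [].
    rewrite /f1 /g1 !patchE rD mem_setE in_itv /= (le_trans r0 (ltW rs)) /=.
    by case: ifP => _; rewrite ?mul0r// mulrC EFinM.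
  rewrite integralZl// EFinM /Rintegral.
  by rewrite fineK//; exact: integrable_fin_num intfr.
have := Fubini ih.
under eq_integral do rewrite /= inner1.
under [X in _ = X -> _]eq_integral do rewrite /= inner2.
have E1 (k : R -> R) :
    (\int[mu]_x ((k \_ D) x)%:E = \int[mu]_(x in D) (k x)%:E)%E.
  by rewrite [RHS]integral_mkcond; apply: eq_integral => x _; rewrite !patchE;
    case: ifP.
by rewrite !E1 /Rintegral => ->.
Qed.

(** Absolute continuity on [0, T] with an explicit density [g]. Keeping the density as an argument
    lets the energy rate be computed algebraically before it is identified with a derivative. *)
Definition primitive_of T f g :=
  mu.-integrable `[0, T] (EFin \o g) /\
  forall t, t \in `[0, T] -> f t = f 0 + \int[mu]_(s in `[0, t]) g s.

Lemma integrable_itv0 T f t : t \in `[0, T] ->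
  mu.-integrable `[0, T] (EFin \o f) -> mu.-integrable `[0, t] (EFin \o f).
Proof.
rewrite in_itv /= => /andP[t0 tT]; apply: integrableS => // s /=.
by rewrite !in_itv /= => /andP[-> st]; exact: le_trans tT.
Qed.

Lemma continuous_bounded_measurable a b f :
  {within `[a, b], continuous f} ->
  measurable_fun `[a, b] f /\ [bounded f x | x in `[a, b]].
Proof.
move=> cf; split; first exact: subspace_continuous_measurable_fun.
have /compact_bounded[M [_ mrt]] :=
  continuous_compact cf (@segment_compact R a b).
by exists M; split; rewrite ?num_real // => ? ? ? ?; exact: mrt.
Qed.

Lemma integrableM_continuous a b f g : {within `[a, b], continuous f} ->
  mu.-integrable `[a, b] (EFin \o g) ->
  mu.-integrable `[a, b] (EFin \o (fun x => f x * g x)).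
Proof.
move=> /continuous_bounded_measurable[mf bf] ig.
exact: integrableRM.
Qed.

Lemma primitive_continuous T f g : 0 <= T -> primitive_of T f g ->
  {within `[0, T], continuous f}.
Proof.
move=> T0 [ig fE].
have c := parameterized_integral_continuous T0 ig.
apply: (@wcont_eq _ _ _ (fun t : R => f 0 + \int[mu]_(s in `[0, t]) g s)).
  by move=> t; rewrite inE => /fE.
by apply: wcontD => //; exact: wcont_cst.
Qed.

Lemma primitive_cst T (c : R) : primitive_of T (fun=> c) (fun=> 0).
Proof.
split=> [|t _]; first by apply: integrable0.
by rewrite Rintegral_cst// mul0r addr0.
Qed.

Lemma primitiveD T f g f' g' : primitive_of T f g -> primitive_of T f' g' ->
  primitive_of T (fun t => f t + f' t) (fun t => g t + g' t).
Proof.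
move=> [ig fE] [ig' fE']; split=> [|t tT].
  exact: integrableRD.
rewrite fE// fE'// RintegralD//; [by ring|exact: integrable_itv0 ig|].
exact: integrable_itv0 ig'.
Qed.

Lemma primitiveZ T f g c : primitive_of T f g ->
  primitive_of T (fun t => c * f t) (fun t => c * g t).
Proof.
move=> [ig fE]; split=> [|t tT].
  exact: integrableRZ.
by rewrite fE// RintegralZl//; [ring|exact: integrable_itv0 ig].
Qed.

Lemma primitive_sum T I (s : seq I) (P : pred I) (f g : I -> R -> R) :
  (forall i, P i -> primitive_of T (f i) (g i)) ->
  primitive_of T (fun t => \sum_(i <- s | P i) f i t)
                 (fun t => \sum_(i <- s | P i) g i t).
Proof.
move=> fg; elim: s => [|i s ih].
  under eq_fun do rewrite big_nil;
    under [X in primitive_of _ _ X]eq_fun do rewrite big_nil.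
  exact: primitive_cst.
under eq_fun do rewrite big_cons;
  under [X in primitive_of _ _ X]eq_fun do rewrite big_cons.
by case Pi: (P i) => //; apply: primitiveD => //; exact: fg.
Qed.

(** Each factor is its initial value plus the integral of its density. After expansion, only the two
    terms coupling a density with the integral of the other are not linear, and [Rintegral_triangle]
    shows that together they make the product of the two full integrals. *)
Lemma primitiveM T f g f' g' : primitive_of T f g -> primitive_of T f' g' ->
  primitive_of T (fun t => f t * f' t) (fun t => f t * g' t + f' t * g t).
Proof.
have [T0|T0] := leP 0 T; last first.
  move=> _ _; split => [|t].
    by rewrite set_itv_ge ?bnd_simp -?ltNge//; exact: integrable_set0.
  by rewrite in_itv /= => /andP[h /(le_trans h)]; rewrite leNgt T0.
move=> pf pf'; have cf := primitive_continuous T0 pf.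
have cf' := primitive_continuous T0 pf'.
move: pf pf' => [ig fE] [ig' fE'].
have i1 := integrableM_continuous cf ig';
  have i2 := integrableM_continuous cf' ig.
split=> [|t tT].
  exact: integrableRD.
have [igt ig't] : mu.-integrable `[0, t] (EFin \o g) /\ mu.-integrable `[0, t]
  (EFin \o g').
  by split; [exact: integrable_itv0 ig|exact: integrable_itv0 ig'].
have t0 : 0 <= t by move: tT; rewrite in_itv /= => /andP[].
have subT s : s \in `[0, t] -> s \in `[0, T].
  move: tT; rewrite !in_itv /= => /andP[_ tT] /andP[-> st].
  exact: le_trans tT.
pose G h s := \int[mu]_(r in `[0, s]) h r.
have cG h : mu.-integrable `[0, t] (EFin \o h) ->
  {within `[0, t], continuous (G h)}.
  exact: parameterized_integral_continuous.
have iGM h k : mu.-integrable `[0, t] (EFin \o h) ->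
  mu.-integrable `[0, t] (EFin \o k) ->
    mu.-integrable `[0, t] (EFin \o (fun s => k s * G h s)).
  move=> /cG ch /(integrableM_continuous ch).
  by congr (integrable _ _ _); apply/funext => x /=; rewrite mulrC.
have -> : \int[mu]_(s in `[0, t]) (f s * g' s + f' s * g s)
    = \int[mu]_(s in `[0, t]) ((f 0 * g' s + f' 0 * g s) +
      (g' s * G g s + g s * G g' s)).
  apply: eq_Rintegral => s; rewrite inE /= => /subT sT.
  by rewrite (fE s)// (fE' s)// /G; ring.
have iZ c h : mu.-integrable `[0, t] (EFin \o h) ->
  mu.-integrable `[0, t] (EFin \o (fun s => c * h s)).
  exact: integrableRZ.
have iD h k : mu.-integrable `[0, t] (EFin \o h) ->
  mu.-integrable `[0, t] (EFin \o k) ->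
    mu.-integrable `[0, t] (EFin \o (fun s => h s + k s)).
  exact: integrableRD.
rewrite RintegralD//; [|by apply: iD; exact: iZ|by apply: iD; exact: iGM].
rewrite RintegralD//; [|exact: iZ|exact: iZ].
rewrite RintegralD//; [|exact: iGM|exact: iGM].
rewrite !RintegralZl// (Rintegral_triangle t0 ig't igt).
(* The integral over ]r, t] is [G g' t - G g' r]; its second part cancels the remaining coupled
   term. *)
have -> : \int[mu]_(r in `[0, t]) (g r * \int[mu]_(s in `]r, t]) g' s)
   = \int[mu]_(r in `[0, t]) (G g' t * g r - g r * G g' r).
  apply: eq_Rintegral => r; rewrite inE /= in_itv /= => /andP[r0 rt].
  have := @Rintegral_itvB R g' (BLeft 0) (BRight t) r ig't.
  by rewrite !bnd_simp => /(_ r0 rt) <-; rewrite /G; ring.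
rewrite RintegralB//; [|exact: iZ|exact: iGM].
by rewrite RintegralZl// (fE t)// (fE' t)// /G; ring.
Qed.

(** Lebesgue differentiation for the extension of [g] by zero. Near a point of the open interval,
    the primitive of this extension coincides with [f]. *)
Lemma primitive_ae_is_derive T f g : primitive_of T f g ->
  {ae mu, forall t, t \in `]0, T[ -> is_derive t 1 f (g t)}.
Proof.
move=> [ig fE].
pose g1 := g \_ `[0, T].
have mD : measurable (`[0, T]%classic : set (measurableTypeR R)) by
  exact: measurable_itv.
have ig1 : mu.-integrable setT (EFin \o g1).
  rewrite -restrict_EFin.
  by apply: (@integrable_mkcond _ (measurableTypeR R) R mu _ (EFin \o g) mD).1
    ig.
have ig1y y : mu.-integrable [set` Interval (BLeft 0) (BRight y)] (EFin \o g1).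
  by apply: integrableS ig1.
have := FTC1 ig1y (integrable_locally_restrict mD ig).
apply: filterS; first exact: (ae_filter_ringOfSetsType mu).
move=> t H; rewrite in_itv /= => /andP[t0 tT].
have [|d1 d2] := H; first by rewrite /= lte_fin.
have : is_derive t 1 (fun y =>
  f 0 + \int[mu]_(s in [set` Interval (BLeft 0) (BRight y)]) g1 s) (0 + g1 t).
  apply: is_deriveD.
  by apply: (DeriveDef d1); rewrite -derive1E; exact: d2.
rewrite add0r /g1 patchE mem_setE in_itv /= (ltW t0) (ltW tT) /=.
apply: near_eq_is_derive.
have /near_in_itvoo : t \in `]0, T[ by rewrite in_itv /= t0.
apply: filterS => y; rewrite in_itv /= => /andP[y0 yT].
rewrite [RHS]fE ?in_itv /= ?(ltW y0) ?(ltW yT)//; congr (_ + _).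
apply: eq_Rintegral => s; rewrite inE /= in_itv /= => /andP[s0 sy].
by rewrite patchE mem_setE in_itv /= s0 (le_trans sy (ltW yT)).
Qed.

(** The integrating factor of [gronwall_primitive], placed in the class where [primitiveM]
    applies. *)
Lemma primitive_expRN T : 0 < T ->
  primitive_of T (fun t => expR (- t)) (fun t => - expR (- t)).
Proof.
move=> T0.
have cN : continuous (fun t : R => - expR (- t)).
  move=> t; apply: cvgN; apply: continuous_comp; last exact: continuous_expR.
  exact: opp_continuous.
have dE (t : R) : is_derive t (1 : R) (fun s : R => expR (- s)) (- expR (- t)).
  by apply: is_derive_eq; rewrite mulrN1.
split=> [|t].
  apply: continuous_compact_integrable; first exact: segment_compact.
  exact: continuous_subspaceT.
rewrite in_itv /= le_eqVlt => /andP[/predU1P[<- _|t0 _]].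
  by rewrite set_itv1 Rintegral_set1 addr0.
have dt s : derivable (fun s : R => expR (- s)) s 1 by case: (dE s).
rewrite /Rintegral (@continuous_FTC2 _ _ (fun s => expR (- s)) 0 t)//=.
- by ring.
- exact: continuous_subspaceT.
- have c (x : R) : {for x, continuous (fun s : R => expR (- s))}.
    exact/differentiable_continuous/derivable1_diffP/dt.
  split; [by move=> x _; exact: dt|apply: cvg_at_right_filter|apply:
    cvg_at_left_filter];
    exact: c.
- by move=> x _; rewrite derive1E; case: (dE x).
Qed.

End primitives.

(** * Continuous matrix-valued functions *)

Section within_continuous_matrix.
Variables (R : realType) (D : set R).

Definition wcont_mx m n (A : R -> 'M[R]_(m, n)) :=
  forall i j, {within D, continuous (fun x => A x i j)}.

Lemma wcont_mxP m n (A : R -> 'M[R]_(m, n)) :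
  {within D, continuous A} -> wcont_mx A.
Proof.
move=> cA i j x; apply: (@continuous_comp _ _ _ (A : subspace D -> _)
  (fun M : 'M[R]_(m, n) => M i j)).
  exact: cA.
exact: coord_continuous.
Qed.

Lemma wcont_mx_cst m n (M : 'M[R]_(m, n)) : wcont_mx (fun=> M).
Proof. by move=> i j; exact: wcont_cst. Qed.

Lemma wcont_mxM m n p (A : R -> 'M[R]_(m, n)) (B : R -> 'M[R]_(n, p)) :
  wcont_mx A -> wcont_mx B -> wcont_mx (fun x => A x *m B x).
Proof.
move=> cA cB i j; under eq_fun do rewrite mxE.
by apply: wcont_sum => k _; apply: wcontM; [exact: cA|exact: cB].
Qed.

Lemma wcont_mx_tr m n (A : R -> 'M[R]_(m, n)) : wcont_mx A ->
  wcont_mx (fun x => (A x)^T).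
Proof. by move=> cA i j; under eq_fun do rewrite mxE; exact: cA. Qed.

Lemma wcont_col_mx m1 m2 n (A : R -> 'M[R]_(m1, n)) (B : R -> 'M[R]_(m2, n)) :
  wcont_mx A -> wcont_mx B -> wcont_mx (fun x => col_mx (A x) (B x)).
Proof.
move=> cA cB i j; under eq_fun do rewrite mxE.
by case: (fintype.split i) => k; [exact: cA|exact: cB].
Qed.

Lemma wcont_row_mx m n1 n2 (A : R -> 'M[R]_(m, n1)) (B : R -> 'M[R]_(m, n2)) :
  wcont_mx A -> wcont_mx B -> wcont_mx (fun x => row_mx (A x) (B x)).
Proof.
move=> cA cB i j; under eq_fun do rewrite mxE.
by case: (fintype.split j) => k; [exact: cA|exact: cB].
Qed.

Lemma wcont_block_mx m1 m2 n1 n2 (A : R -> 'M[R]_(m1, n1)) B C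
    (E : R -> 'M[R]_(m2, n2)) :
  wcont_mx A -> wcont_mx B -> wcont_mx C -> wcont_mx E ->
  wcont_mx (fun x => block_mx (A x) (B x) (C x) (E x)).
Proof.
by move=> cA cB cC cE; apply: wcont_col_mx; apply: wcont_row_mx.
Qed.

Lemma wcont_det n (A : R -> 'M[R]_n) : wcont_mx A ->
  {within D, continuous (fun x => \det (A x))}.
Proof.
move=> cA; rewrite /determinant; apply: wcont_sum => s _.
apply: wcontM; first exact: wcont_cst.
by apply: wcont_prod => i _; exact: cA.
Qed.

(** Cramer's formula: the entries of the inverse are cofactors divided by the determinant, and
    determinants are polynomial in the entries. *)
Lemma wcont_invmx n (A : R -> 'M[R]_n) : (forall x, D x -> A x \in unitmx) ->
  wcont_mx A -> wcont_mx (fun x => invmx (A x)).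
Proof.
move=> uA cA i j.
apply: (wcont_eq (f := fun x : R => (\det (A x))^-1 * cofactor (A x) j i)).
  by move=> x /set_mem /uA Au; rewrite /invmx Au !mxE.
apply: wcontM.
  by apply: wcontV (wcont_det cA) => x /uA; rewrite unitmxE unitfE.
apply: wcontM; first exact: wcont_cst.
by apply: wcont_det => k l; under eq_fun do rewrite !mxE; exact: cA.
Qed.

Lemma wcont_dotv n (f g : R -> 'cV[R]_n) : wcont_mx f -> wcont_mx g ->
  {within D, continuous (fun x => dotv (f x) (g x))}.
Proof.
move=> cf cg; apply: wcont_mxM => //; exact: wcont_mx_tr.
Qed.

Lemma wcont_ev n (p : 'cV[{poly R}]_n) : wcont_mx (ev p).
Proof.
move=> i j; under eq_fun do rewrite mxE.
by apply: continuous_subspaceT; exact: continuous_horner.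
Qed.

Lemma wcont_tilde (a : R -> 'cV[R]_3) : wcont_mx a ->
  wcont_mx (fun x => tilde (a x)).
Proof.
move=> ca i j; under eq_fun do rewrite mxE.
case: i => -[|[|[|//]]] hi; case: j => -[|[|[|//]]] hj /=;
  try exact: wcont_cst; try exact: ca;
  by apply: wcontN; exact: ca.
Qed.
End within_continuous_matrix.

(** * Power of the source term *)

Lemma tilde_tr (R : realType) (a : 'cV[R]_3) : (tilde a)^T = - tilde a.
Proof.
apply/matrixP => i j; rewrite !mxE.
by case: i => -[|[|[|//]]] hi; case: j => -[|[|[|//]]] hj /=;
  rewrite ?oppr0 ?opprK.
Qed.

Lemma tilde_mulC (R : realType) (a b : 'cV[R]_3) :
  tilde a *m b = - (tilde b *m a).
Proof.
have o1 : lift ord0 ord0 = inord 1 :> 'I_3 by apply: val_inj; rewrite /= inordK.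
have o2 : lift ord0 (lift ord0 ord0) = inord 2 :> 'I_3 by apply: val_inj;
  rewrite /= inordK.
have o0 : ord0 = inord 0 :> 'I_3 by apply: val_inj; rewrite /= inordK.
apply/matrixP => i j; rewrite !mxE !big_ord_recl !big_ord0 !mxE !ord1 /=.
rewrite o2 o1 o0.
by case: i => -[|[|[|//]]] hi /=; ring.
Qed.

Lemma tilde_mulE (R : realType) (a : 'cV[R]_3) : tilde a *m a = 0.
Proof.
apply/eqP; have /eqP := tilde_mulC a a; rewrite -addr_eq0 -mulr2n -scaler_nat.
by rewrite scaler_eq0 pnatr_eq0.
Qed.

(** The blocks are - c2 x c1 - c1 x c2 and - c2 x c2, both zero as the cross product is
    alternating. *)
Lemma L1_tr_self (R : realType) (c : 'cV[R]_(3 + 3)) : (L1 c)^T *m c = 0.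
Proof.
rewrite -[X in _ *m X](vsubmxK c) /L1 tr_block_mx trmx0 !tilde_tr mul_block_col.
rewrite !mul0mx add0r !mulNmx (tilde_mulC (usubmx c)) opprK tilde_mulE oppr0.
by rewrite addNr col_mx0.
Qed.

(** Both sides have blocks c2 x a1 and c1 x a1 + c2 x a2, up to anticommutation of the cross
    product. *)
Lemma L2_tr_L1 (R : realType) (a c : 'cV[R]_(3 + 3)) :
  (L2 a)^T *m c = L1 c *m a.
Proof.
rewrite -[X in _ *m X = _](vsubmxK c) -[X in _ = _ *m X](vsubmxK a).
rewrite /L2 /L1 tr_block_mx trmx0 !tilde_tr.
rewrite !mul_block_col !mul0mx add0r addr0 !mulNmx.
by rewrite (tilde_mulC (usubmx c)) !(tilde_mulC (dsubmx c)).
Qed.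

Lemma evE (R : realType) n (p : 'cV[{poly R}]_n) y i j :
  ev p y i j = (p i j).[y].
Proof. by rewrite mxE. Qed.

Lemma ev_up1_dn2 (R : realType) (u : broken R ((3 + 3) + (3 + 3))) i y :
  ev (u i) y = col_mx (ev (up1 u i) y) (ev (dn2 u i) y).
Proof. by rewrite /ev -map_col_mx vsubmxK. Qed.

Lemma ev_rfull (R : realType) (r : broken R (3 + 3)) i y :
  ev (rfull r i) y = col_mx 0 (ev (r i) y).
Proof.
rewrite /ev map_col_mx; congr col_mx.
by apply/matrixP => k l; rewrite !mxE horner0.
Qed.

(** The inertial term does no work ([L1E]); the [E] and [L2] terms in u2 cancel against the second
    row ([EE], [L2E]). The terms in r remain, and they are the opposite of the volume terms on the
    right of (DG2) tested with r. *)
Lemma Qsrc_power (R : realType) (b : beam R) fe t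
    (u : broken R ((3 + 3) + (3 + 3))) (r : broken R (3 + 3)) i y :
  dotv (Qsrc b fe t u r i y) (ev (u i) y) =
    dotv ((Emx b y)^T *m ev (up1 u i) y) (ev (r i) y)
    - dotv ((L1 (ev (up1 u i) y))^T *m Comp b y *m ev (dn2 u i) y) (ev (r i) y)
    + dotv (ev (u i) y) (qext fe t y).
Proof.
rewrite /Qsrc dotvDl [dotv (qext _ _ _) _]dotvC; congr (_ + _).
rewrite ev_up1_dn2.
set u1 := ev (up1 u i) y; set u2 := ev (dn2 u i) y; set rt := ev (r i) y.
set E := Emx b y; rewrite dotv_col -!mulmxA; set cu := Comp b y *m u2.
clearbody cu E rt u2 u1.
have L1E x : dotv (L1 u1 *m x) u1 = 0.
  by rewrite dotvC dotv_mulmx L1_tr_self dotv0l.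
have L2E a : dotv (L2 a *m cu) u1 = dotv ((L1 u1)^T *m cu) a.
  by rewrite [LHS]dotvC [LHS]dotv_mulmx L2_tr_L1 [LHS]dotvC dotv_mulmx.
have EE a : dotv (E *m a) u1 = dotv (E^T *m u1) a.
  by rewrite dotvC dotv_mulmx.
rewrite mulNmx !dotvDl !dotvNl L1E !L2E !EE.
move: (dotv _ u2) (dotv _ rt) (dotv _ u2) (dotv _ rt) => x1 x2 x3 x4.
by ring.
Qed.

(** * Coefficients and cells *)

Lemma unif_spd_spd (R : realType) n l (A : R -> 'M[R]_n) x :
  unif_spd l A -> x \in `[0, l] -> spd (A x).
Proof.
move=> [symA [c c0 posA]] xl; split=> [|z z0]; first exact: symA.
by apply: lt_le_trans (posA _ xl z); rewrite mulr_gt0// dotvv_gt0.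
Qed.

Section beam_coefficients.
Variables (R : realType) (b : beam R).
Hypothesis coef : standing_hyps b.
Local Notation D := `[0, ell b].

Lemma spd_Mass x : x \in D -> spd (Mass b x).
Proof. by case: coef => _ h _ _; exact: unif_spd_spd. Qed.

Lemma spd_Comp x : x \in D -> spd (Comp b x).
Proof. by case: coef => _ _ h _; exact: unif_spd_spd. Qed.

Lemma spd_Hmx x : x \in D -> spd (Hmx b x).
Proof. by case: coef => _ _ _ h; exact: unif_spd_spd. Qed.

Lemma spd_Gam_in x : x \in D -> spd (Gam b x).
Proof. by move=> xD; apply: spd_Gam; [exact: spd_Mass|exact: spd_Comp]. Qed.

Lemma wcont_Mass : wcont_mx [set` D] (Mass b).
Proof. by case: coef => -[? _ _ _] _ _ _; exact: wcont_mxP. Qed.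

Lemma wcont_Comp : wcont_mx [set` D] (Comp b).
Proof. by case: coef => -[_ ? _ _] _ _ _; exact: wcont_mxP. Qed.

Lemma wcont_Gam : wcont_mx [set` D] (Gam b).
Proof.
apply: wcont_block_mx; [exact: wcont_Mass|exact: wcont_mx_cst..|].
exact: wcont_Comp.
Qed.

Lemma wcont_invGam : wcont_mx [set` D] (fun x => invmx (Gam b x)).
Proof.
by apply: wcont_invmx wcont_Gam => x /= xD; exact/spd_unitmx/spd_Gam_in.
Qed.

Lemma wcont_invHmx : wcont_mx [set` D] (fun x => invmx (Hmx b x)).
Proof.
apply: wcont_invmx => [x /= xD|]; first exact/spd_unitmx/spd_Hmx.
apply: wcont_mxM.
  by case: coef => -[_ _ ? _] _ _ _; exact: wcont_mxP.
by apply: wcont_invmx wcont_Comp => x /= xD; exact/spd_unitmx/spd_Comp.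
Qed.

Lemma wcont_Emx : wcont_mx [set` D] (Emx b).
Proof.
have ck : wcont_mx [set` D] (fun x => tilde (kappa0 b x)).
  by apply: wcont_tilde; case: coef => -[_ _ _ ?] _ _ _; exact: wcont_mxP.
by apply: wcont_block_mx => //; exact: wcont_mx_cst.
Qed.

Lemma wcont_L1 (D' : set R) (c : R -> 'cV[R]_(3 + 3)) : wcont_mx D' c ->
  wcont_mx D' (fun x => L1 (c x)).
Proof.
move=> cc.
have cd : wcont_mx D' (fun x => tilde (dsubmx (c x))).
  by apply: wcont_tilde => i j; under eq_fun do rewrite mxE; exact: cc.
have cu : wcont_mx D' (fun x => tilde (usubmx (c x))).
  by apply: wcont_tilde => i j; under eq_fun do rewrite mxE; exact: cc.
by apply: wcont_block_mx => //; exact: wcont_mx_cst.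
Qed.

End beam_coefficients.

(** * Cells of the mesh *)

Section cells.
Variables (R : realType) (m : mesh R) (l : R).
Hypothesis meshP : mesh_of m l.
Local Notation mu := (@lebesgue_measure R).

Definition cell i : set (measurableTypeR R) := `[node m i.-1, node m i].

Lemma node_le i j : (i <= j <= ncells m)%N -> node m i <= node m j.
Proof.
case: meshP => _ _ _ inc /andP[ij jN].
elim: j ij jN => [|j IH]; first by rewrite leqn0 => /eqP->.
rewrite leq_eqVlt => /predU1P[->//|ij] jN.
by rewrite (le_trans (IH ij (ltnW jN)))// ltW// inc.
Qed.

Lemma node_in i : (i <= ncells m)%N -> node m i \in `[0, l].
Proof.
case: meshP => _ n0 nl _ iN.
by rewrite in_itv /= -{1}n0 -nl !node_le// ?leqnn ?iN.
Qed.

Lemma cell_sub i : (1 <= i <= ncells m)%N -> cell i `<=` `[0, l].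
Proof.
move=> /andP[i0 iN] x; rewrite /cell /= !in_itv /= => /andP[h1 h2].
have := node_in iN; have := node_in (leq_trans (leq_pred _) iN).
rewrite !in_itv /= => /andP[h3 _] /andP[_ h4].
by rewrite (le_trans h3 h1) (le_trans h2 h4).
Qed.

Lemma cell_lt i : (1 <= i <= ncells m)%N -> node m i.-1 < node m i.
Proof.
by case: meshP => _ _ _ inc; case: i => // i /andP[_ iN]; exact: inc.
Qed.

Lemma wcont_cell n p (A : R -> 'M[R]_(n, p)) i : (1 <= i <= ncells m)%N ->
  wcont_mx `[0, l] A -> wcont_mx (cell i) A.
Proof.
by move=> iN cA j k; apply: continuous_subspaceW (cA j k); exact: cell_sub.
Qed.

Lemma cell_integrable i (f : R -> R) : {within cell i, continuous f} ->
  mu.-integrable (cell i) (EFin \o f).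
Proof. by apply: continuous_compact_integrable; exact: segment_compact. Qed.

Lemma cell_dotv_integrable n i (f g : R -> 'cV[R]_n) :
  wcont_mx (cell i) f -> wcont_mx (cell i) g ->
  mu.-integrable (cell i) (EFin \o (fun y => dotv (f y) (g y))).
Proof. by move=> cf cg; apply: cell_integrable; exact: wcont_dotv. Qed.

(** Integration by parts on a cell in the only form needed: after testing a form with the solution
    itself, its volume integrand is the derivative of a polynomial. *)
Lemma ip_derivative n i (f g : R -> 'cV[R]_n) (P : {poly R}) :
  (1 <= i <= ncells m)%N ->
  (forall y, dotv (f y) (g y) = P^`().[y]) ->
  ip m i f g = P.[node m i] - P.[node m i.-1].
Proof.
move=> iN fgP; rewrite /ip /Rintegral.
under eq_integral do rewrite fgP.
rewrite (@continuous_FTC2 _ _ (horner P))//; first exact: cell_lt.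
- by apply: continuous_subspaceT; exact: continuous_horner.
- by split => [x _||]; [exact: derivable_horner|apply: cvg_at_right_filter|
    apply: cvg_at_left_filter]; exact: continuous_horner.
- by move=> x _; rewrite -derivE.
Qed.

End cells.

(** Regrouping by nodes: [a i] is a left limit, coming from cell i, and [c i] a right limit, coming
    from the next cell. *)
Lemma sum_cells_nodes (R : realType) N (a c : nat -> R) : (0 < N)%N ->
  \sum_(1 <= i < N.+1) (a i - c i.-1)
  = \sum_(1 <= i < N) (a i - c i) + (a N - c 0%N).
Proof.
case: N => // N _; elim: N => [|N IH].
  by rewrite big_nat1 big_geq// add0r.
rewrite big_nat_recr//= IH [in RHS]big_nat_recr//=; ring.
Qed.

(** * Cancellation of the interface fluxes *)

Lemma Pimx_col (R : realType) (a c : 'cV[R]_(3 + 3)) :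
  Pimx R *m col_mx a c = col_mx (- c) (- a).
Proof. by rewrite /Pimx mul_block_col !mul0mx add0r addr0 !mulNmx !mul1mx. Qed.

(* Pi pairs velocities with stresses, so the central part of the flux tested
   with the jump is the jump of - u1 . u2. *)
Lemma central_flux_jump (R : realType) (a c a' c' : 'cV[R]_(3 + 3)) :
  dotv (Pimx R *m (2^-1 *: (col_mx a c + col_mx a' c')))
       (col_mx a c - col_mx a' c')
  = - dotv a c - - dotv a' c'.
Proof.
rewrite opp_col_mx !add_col_mx scale_col_mx Pimx_col dotv_col.
rewrite !(dotvDl, dotvDr, dotvNl, dotvNr, dotvZl) (dotvC c a) (dotvC c a')
  (dotvC c' a) (dotvC c' a').
move: (dotv _ _) (dotv _ _) (dotv _ _) (dotv _ _) => x1 x2 x3 x4.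
by field.
Qed.

Section traces.
Variables (R : realType) (m : mesh R).
Implicit Types u : broken R ((3 + 3) + (3 + 3)).

Lemma trm_col u i : trm m u i = col_mx (trm m (up1 u) i) (trm m (dn2 u) i).
Proof. exact: ev_up1_dn2. Qed.

Lemma trp_col u i : trp m u i = col_mx (trp m (up1 u) i) (trp m (dn2 u) i).
Proof. exact: (ev_up1_dn2 u i.+1). Qed.

End traces.

(** [dotv] at the level of polynomials, where the product rule is algebraic. *)
Definition dotp (R : realType) n (p q : 'cV[{poly R}]_n) : {poly R} :=
  \sum_j p j 0 * q j 0.

Lemma horner_dotp (R : realType) n (p q : 'cV[{poly R}]_n) y :
  (dotp p q).[y] = dotv (ev p y) (ev q y).
Proof.
by rewrite horner_sum dotvE; apply: eq_bigr => j _; rewrite hornerM !evE.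
Qed.

Lemma deriv_dotp (R : realType) n (p q : 'cV[{poly R}]_n) :
  (dotp p q)^`() = dotp (dx p) q + dotp p (dx q).
Proof.
rewrite /dotp (raddf_sum (@deriv R)) -big_split /=; apply: eq_bigr => j _.
by rewrite derivM !mxE.
Qed.

Lemma up1_dx (R : realType) (p : 'cV[{poly R}]_((3 + 3) + (3 + 3))) y :
  ev (dx p) y = col_mx (ev (dx (usubmx p)) y) (ev (dx (dsubmx p)) y).
Proof. by rewrite /ev /dx -map_col_mx -map_col_mx vsubmxK. Qed.

Section flux_identities.
Variables (R : realType) (b : beam R) (m : mesh R).
Hypothesis coef : standing_hyps b.
Hypothesis ell_gt0 : 0 < ell b.
Hypothesis meshP : mesh_of m (ell b).
Implicit Types (u : broken R ((3 + 3) + (3 + 3))) (r : broken R (3 + 3)).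
Local Notation N := (ncells m).

Let N0 : (0 < N)%N. Proof. by case: meshP. Qed.

Lemma Gam_absmx_in x : x \in `[0, ell b] ->
  Gam b x *m absmx (Amx b x) = block_mx (S0_at b x) 0 0 (Sell_at b x).
Proof. by move=> xD; apply: Gam_absmx; [exact: spd_Mass|exact: spd_Comp]. Qed.

Lemma ip_Pimx_dx u i : (1 <= i <= N)%N ->
  ip m i (fun y => Pimx R *m ev (u i) y) (ev (dx (u i)))
  = - dotv (trm m (up1 u) i) (trm m (dn2 u) i)
    - - dotv (trp m (up1 u) i.-1) (trp m (dn2 u) i.-1).
Proof.
move=> iN; rewrite (@ip_derivative _ _ _ meshP _ _ _ _
  (- dotp (up1 u i) (dn2 u i)))//.
  rewrite !hornerN !horner_dotp /trm /trp.
  by case: i iN => // i _ /=.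
move=> y; rewrite derivN deriv_dotp hornerN hornerD !horner_dotp.
rewrite ev_up1_dn2 up1_dx Pimx_col dotv_col !dotvNl -opprD.
by rewrite [dotv (ev (dn2 u i) y) _]dotvC.
Qed.

Lemma calA_energy sigma u :
  calA b m sigma u u = - jump_diss b m sigma u - bdry_diss b m u.
Proof.
rewrite /calA /=.
under eq_big_nat => i iN do rewrite ip_Pimx_dx//.
rewrite (sum_cells_nodes (fun i => - dotv (trm m (up1 u) i) (trm m (dn2 u) i))
  (fun i => - dotv (trp m (up1 u) i) (trp m (dn2 u) i)))//.
rewrite [X in _ - X - _](_ : _ = \sum_(1 <= i < N)
   (- dotv (trm m (up1 u) i) (trm m (dn2 u) i)
    - - dotv (trp m (up1 u) i) (trp m (dn2 u) i)) + jump_diss b m sigma u);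
      last first.
  rewrite /jump_diss -big_split /=; apply: eq_big_nat => i /andP[i0 iN].
  rewrite /Piu_hat (gtn_eqF i0) (ltn_eqF iN) /charflux dotvDl /jump;
    congr (_ + _).
  by rewrite trm_col trp_col central_flux_jump.
have [_ n0 nl _] := meshP.
(* Because S_ell S_0 = 1, the outer state makes the boundary flux (- u2 - S_0 u1, 0): the central
   and upwind contributions cancel in the second component. *)
have e0 : dotv (Piu_hat b m sigma u 0) (trp m u 0) =
   - dotv (trp m (up1 u) 0) (trp m (dn2 u) 0)
   - dotv (trp m (up1 u) 0) (S0 b *m trp m (up1 u) 0).
  have D0 : 0 \in `[0, ell b] by rewrite in_itv /= lexx ltW.
  rewrite /Piu_hat eqxx /charflux n0 Gam_absmx_in// trp_col /outer0.
  set a := trp m (up1 u) 0; set c := trp m (dn2 u) 0.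
  rewrite -[S0 b]/(S0_at b 0) opp_col_mx !add_col_mx scale_col_mx Pimx_col
    mul_block_col.
  have -> : c + S0_at b 0 *m a - c = S0_at b 0 *m a by rewrite addrC addKr.
  rewrite (mulmxA (Sell_at b 0)) Sell_at_S0_at;
    [|exact: spd_Mass|exact: spd_Comp].
  rewrite !sub0r mulmxN !mul0mx addr0 !add0r mul1mx scale_col_mx add_col_mx
    dotv_col.
  rewrite !(dotvDl, dotvNl, dotvZl) (dotvC c a) (dotvC (S0_at b 0 *m a) a).
  by move: (dotv _ _) (dotv _ _) => x1 x2; field.
(* Symmetrically, the flux at the right end is (0, - u1 + S_ell u2). *)
have eN : dotv (Piu_hat b m sigma u N) (trm m u N) =
   - dotv (trm m (up1 u) N) (trm m (dn2 u) N)
   + dotv (trm m (dn2 u) N) (Sell b *m trm m (dn2 u) N).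
  have Dl : ell b \in `[0, ell b] by rewrite in_itv /= lexx ltW.
  rewrite /Piu_hat (gtn_eqF N0) eqxx /charflux nl Gam_absmx_in// trm_col
    /outerl.
  set a := trm m (up1 u) N; set c := trm m (dn2 u) N.
  rewrite -[Sell b]/(Sell_at b (ell b)); set x := ell b.
  rewrite opp_col_mx !add_col_mx scale_col_mx Pimx_col mul_block_col subKr.
  rewrite (mulmxA (S0_at b x)) S0_at_Sell_at;
    [|exact: spd_Mass|exact: spd_Comp].
  rewrite oppr0 !addr0 !mul0mx addr0 !add0r mul1mx scale_col_mx add_col_mx
    dotv_col.
  rewrite !(dotvDl, dotvNl, dotvZl) (dotvC c a) (dotvC (Sell_at b x *m c) c).
  by move: (dotv _ _) (dotv _ _) => x1 x2; field.
rewrite e0 eN /bdry_diss.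
move: (\sum_(1 <= i < N) _) (jump_diss _ _ _ _) (dotv _ _) (dotv _ _)
  (dotv _ _) (dotv _ _).
by move=> *; ring.
Qed.

(** The two product rules for jumps: [[a b]] = a^- [[b]] + b^+ [[a]], and the same with averages in
    both places. *)
Lemma trace_pair_compatible u r uh rh :
  alternating_pair m u r uh rh \/ BR1_pair m u r uh rh ->
  compatible_pair m u r uh rh.
Proof.
case=> h i /h[-> ->]; rewrite /jump /avg.
  rewrite !(dotvDr, dotvNr) (dotvC (trp m r i)) (dotvC (trp m r i)).
  by move: (dotv _ _) (dotv _ _) (dotv _ _) => *; ring.
rewrite !(dotvDl, dotvDr, dotvNl, dotvNr, dotvZl).
rewrite !(dotvC (trp m r i)) !(dotvC (trm m r i)).
by move: (dotv _ _) (dotv _ _) (dotv _ _) (dotv _ _) => *; field.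
Qed.

(* Only the difference of the two integrands is a derivative; it is written as
   a dot product in dimension 1 to fall under ip_derivative. *)
Lemma ip_Pir_dx u r i : (1 <= i <= N)%N ->
  ip m i (fun y => Pimx R *m ev (rfull r i) y) (ev (dx (u i)))
  - ip m i (ev (up1 u i)) (ev (dx (r i)))
  = - dotv (trm m (up1 u) i) (trm m r i)
    - - dotv (trp m (up1 u) i.-1) (trp m r i.-1).
Proof.
move=> iN.
have e y : dotv (Pimx R *m ev (rfull r i) y) (ev (dx (u i)) y)
    = - dotv (ev (r i) y) (ev (dx (up1 u i)) y).
  by rewrite ev_rfull up1_dx Pimx_col dotv_col oppr0 dotv0l addr0 dotvNl.
pose f y := - dotv (ev (r i) y) (ev (dx (up1 u i)) y).
pose g y := dotv (ev (up1 u i) y) (ev (dx (r i)) y).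
have -> : ip m i (fun y => Pimx R *m ev (rfull r i) y) (ev (dx (u i))) - ip m i
  (ev (up1 u i)) (ev (dx (r i)))
    = ip m i (fun y => (f y - g y)%:M : 'cV[R]_1) (fun=> 1%:M).
  rewrite /ip -RintegralB//; first last.
  - by apply: cell_dotv_integrable; exact: wcont_ev.
  - apply: cell_dotv_integrable; last exact: wcont_ev.
    by apply: wcont_mxM; [exact: wcont_mx_cst|exact: wcont_ev].
  by apply: eq_Rintegral => y _;
    rewrite e [in RHS]dotvE big_ord1 !mxE !eqxx mulr1.
rewrite (@ip_derivative _ _ _ meshP _ _ _ _ (- dotp (up1 u i) (r i)))//.
  rewrite !hornerN !horner_dotp /trm /trp.
  by case: i iN {e f g} => // i _ /=.
move=> y; rewrite dotvE big_ord1 !mxE !eqxx mulr1 derivN deriv_dotp hornerN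
  hornerD !horner_dotp.
by rewrite /f /g opprD [dotv (ev (r i) y) _]dotvC.
Qed.

(** Pi sends r to - r in the velocity slot, so the interface terms of the two forms combine into the
    jump of u1 . r by compatibility. At each end one of the two auxiliary traces is zero and the
    other is the interior one, which supplies the single product u1 . r left by the telescoping. *)
Lemma calB_calC_cancel u r uh rh : compatible_pair m u r uh rh ->
  calB m r rh u + calC m u uh r = 0.
Proof.
move=> comp; rewrite /calB /calC /=.
have {comp}E : \sum_(1 <= i < N) dotv (Pir_hat m r rh i) (jump m u i)
    = \sum_(1 <= i < N) dotv (u1_hat m u uh i) (jump m r i)
    + \sum_(1 <= i < N) (- dotv (trm m (up1 u) i) (trm m r i)
    - - dotv (trp m (up1 u) i) (trp m r i)).
  rewrite -big_split /=; apply: eq_big_nat => i /andP[i0 iN].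
  have := comp i; rewrite i0 iN => /(_ isT).
  rewrite /Pir_hat /u1_hat (gtn_eqF i0) (ltn_eqF iN) Pimx_col oppr0.
  rewrite [jump m u i](_ : _ = col_mx (jump m (up1 u) i) (jump m (dn2 u) i)).
    by rewrite dotv_col dotv0l addr0 dotvNl; lra.
  by rewrite /jump trm_col trp_col opp_col_mx add_col_mx.
have := sum_cells_nodes (fun i => - dotv (trm m (up1 u) i) (trm m r i))
  (fun i => - dotv (trp m (up1 u) i) (trp m r i)) N0.
rewrite -(eq_big_nat _ _ (fun i (iN : (1 <= i < N.+1)%N) => ip_Pir_dx u r iN)).
rewrite sumrB => F; rewrite E.
have -> : Pir_hat m r rh N = 0 by rewrite /Pir_hat (gtn_eqF N0) eqxx.
have -> : u1_hat m u uh N = trm m (up1 u) N by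
  rewrite /u1_hat (gtn_eqF N0) eqxx.
have -> : u1_hat m u uh 0 = 0 by [].
have -> : dotv (Pir_hat m r rh 0) (trp m u 0) = - dotv (trp m (up1 u) 0)
  (trp m r 0).
  rewrite /Pir_hat eqxx [trp m (rfull r) 0]ev_rfull Pimx_col trp_col dotv_col.
  by rewrite oppr0 dotv0l addr0 dotvNl dotvC.
rewrite !dotv0l; move: F.
move: (\sum_(_ <= _ < _) _) (\sum_(_ <= _ < _) _) (\sum_(_ <= _ < _) _)
  (\sum_(_ <= _ < _) _).
move: (dotv _ _) (dotv _ _) => *; lra.
Qed.

End flux_identities.

(** * Power balance at a fixed time *)

Section power_balance.
Variables (R : realType) (b : beam R) (m : mesh R) (fe : R -> R ->
  'cV[R]_(3 + 3)).
Hypothesis coef : standing_hyps b.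
Hypothesis ell_gt0 : 0 < ell b.
Hypothesis meshP : mesh_of m (ell b).
Local Notation N := (ncells m).
Local Notation mu := (@lebesgue_measure R).

Lemma cell_dotv_integrable_r n i (f g : R -> 'cV[R]_n) :
  wcont_mx (cell m i) f ->
  (forall j, mu.-integrable (cell m i) (fun x => (g x j 0)%:E)) ->
  mu.-integrable (cell m i) (EFin \o (fun y => dotv (f y) (g y))).
Proof.
move=> cf ig.
rewrite (_ : (fun y => _) = (fun y => \sum_j f y j 0 * g y j 0)); last first.
  by apply/funext => y; rewrite dotvE.
apply: integrableR_sum => [|j _]; first exact: measurable_itv.
by apply: integrableM_continuous; [exact: cf|exact: ig].
Qed.

Lemma integrable_cell i f : (1 <= i <= N)%N ->
  mu.-integrable `[0, ell b] f -> mu.-integrable (cell m i) f.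
Proof.
by move=> iN; apply: integrableS; [exact: measurable_itv..|exact: cell_sub].
Qed.

Lemma load_integrable t i (u : broken R ((3 + 3) + (3 + 3))) :
  (1 <= i <= N)%N ->
  (forall j, mu.-integrable `[0, ell b] (fun x => (fe x t j 0)%:E)) ->
  mu.-integrable (cell m i) (EFin \o
    (fun y => dotv (ev (u i) y) (qext fe t y))).
Proof.
move=> iN ife; apply: cell_dotv_integrable_r; first exact: wcont_ev.
move=> j; rewrite /qext; under eq_fun do rewrite mxE.
case: (fintype.split j) => k.
  exact: integrable_cell (ife k).
under eq_fun do rewrite mxE; exact: integrable0.
Qed.

Lemma source_power t u r :
  (forall j, mu.-integrable `[0, ell b] (fun x => (fe x t j 0)%:E)) ->
  \sum_(1 <= i < N.+1) ip m i (Qsrc b fe t u r i) (ev (u i)) =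
    \sum_(1 <= i < N.+1) ip m i (fun y => (Emx b y)^T *m ev (up1 u i) y)
      (ev (r i))
  - \sum_(1 <= i < N.+1) ip m i (fun y => (L1 (ev (up1 u i) y))^T *m Comp b y
                         *m ev (dn2 u i) y) (ev (r i))
  + \sum_(1 <= i < N.+1) ip m i (ev (u i)) (qext fe t).
Proof.
move=> ife; rewrite -sumrB -big_split /=; apply: eq_big_nat => i iN.
have mc : measurable (cell m i) by exact: measurable_itv.
have i1 : mu.-integrable (cell m i)
    (EFin \o (fun y => dotv ((Emx b y)^T *m ev (up1 u i) y) (ev (r i) y))).
  apply: cell_dotv_integrable; last exact: wcont_ev.
  apply: wcont_mxM; last exact: wcont_ev.
  by apply: (wcont_cell meshP) => //; exact/wcont_mx_tr/wcont_Emx.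
have i2 : mu.-integrable (cell m i)
    (EFin \o (fun y => dotv ((L1 (ev (up1 u i) y))^T *m Comp b y *m ev
      (dn2 u i) y) (ev (r i) y))).
  apply: cell_dotv_integrable; last exact: wcont_ev.
  apply: wcont_mxM; last exact: wcont_ev.
  apply: wcont_mxM; first by apply/wcont_mx_tr/wcont_L1/wcont_ev.
  by apply: (wcont_cell meshP) => //; exact: wcont_Comp.
rewrite /ip -RintegralB// -RintegralD//;
  [|exact: integrableRB|exact: load_integrable].
by apply: eq_Rintegral => y _; rewrite Qsrc_power.
Qed.

Lemma power_balance sigma u r uh rh t :
  (forall j, mu.-integrable `[0, ell b] (fun x => (fe x t j 0)%:E)) ->
  compatible_pair m (u t) (r t) (uh t) (rh t) ->
  DG1 b m fe sigma u r rh t (u t) -> DG2 b m u r uh t (r t) ->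
  \sum_(1 <= i < N.+1) ip m i (fun y => Gam b y *m dt u t i y) (ev (u t i))
  + jump_diss b m sigma (u t) + r_diss b m (r t) + bdry_diss b m (u t)
  = \sum_(1 <= i < N.+1) ip m i (ev (u t i)) (qext fe t).
Proof.
move=> ife comp; rewrite /DG1 /DG2 -/(r_diss b m (r t)) source_power//.
rewrite (calA_energy coef ell_gt0 meshP) => -> ->.
have := calB_calC_cancel meshP comp.
move: (calB _ _ _ _) (calC _ _ _ _) (\sum_(_ <= _ < _) _) (\sum_(_ <= _ < _) _)
  (\sum_(_ <= _ < _) _) (jump_diss _ _ _ _) (bdry_diss _ _ _) => *; lra.
Qed.

End power_balance.

(** * The energy as a function of time *)

Section almost_everywhere.
Context d (U : measurableType d) (R : realType)
  (nu : {measure set U -> \bar R}).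

Lemma ae_imp (P Q : U -> Prop) : (forall t, P t -> Q t) ->
  {ae nu, forall t, P t} -> {ae nu, forall t, Q t}.
Proof. by move=> PQ; apply: filterS => //; exact: ae_filter_ringOfSetsType. Qed.

Lemma ae_and (P Q : U -> Prop) : {ae nu, forall t, P t} ->
  {ae nu, forall t, Q t} -> {ae nu, forall t, P t /\ Q t}.
Proof. by move=> aP aQ; apply: filterI => //;
  exact: ae_filter_ringOfSetsType. Qed.

Lemma ae_forall_countType (I : countType) (P : I -> U -> Prop) :
  (forall i, {ae nu, forall t, P i t}) -> {ae nu, forall t, forall i, P i t}.
Proof.
move=> aP.
have : {ae nu, forall t, forall n,
  (if unpickle n is Some i then P i t else True)}.
  apply: ae_foralln => n; case: unpickle => [i|]; first exact: aP.
  by apply: aeW.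
by apply: ae_imp => t H i; have := H (pickle i); rewrite pickleK.
Qed.

End almost_everywhere.

(** * Inner products as bilinear forms in the polynomial coefficients *)

Section moments.
Variables (R : realType) (m : mesh R).
Local Notation mu := (@lebesgue_measure R).

(** The Gram matrix of the weight [A] on a cell in the basis of monomial vector fields, an index
    being a pair (component, degree). It does not depend on time, so time regularity and
    measurability pass from the coefficients to the inner products. *)
Definition moment n (k : nat) (A : R -> 'M[R]_n) i (s s' : 'I_n * 'I_k.+1) : R
  :=
  \int[mu]_(y in cell m i) (A y s'.1 s.1 * (y ^+ s.2 * y ^+ s'.2)).

Lemma ip_moments n (k : nat) (A : R -> 'M[R]_n) i (p q : 'cV[{poly R}]_n) :
  wcont_mx (cell m i) A ->
  (forall j, (size (p j 0%R) <= k.+1)%N) ->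
    (forall j, (size (q j 0%R) <= k.+1)%N) ->
  ip m i (fun y => A y *m ev p y) (ev q) =
  \sum_(s : 'I_n * 'I_k.+1) \sum_(s' : 'I_n * 'I_k.+1)
    (p s.1 0)`_s.2 * (q s'.1 0)`_s'.2 * moment A i s s'.
Proof.
move=> cA sp sq.
have mc : measurable (cell m i) by exact: measurable_itv.
have ci (s s' : 'I_n * 'I_k.+1) : mu.-integrable (cell m i)
    (EFin \o (fun y => A y s'.1 s.1 * (y ^+ s.2 * y ^+ s'.2))).
  apply: cell_integrable; apply: wcontM; first exact: cA.
  by apply: wcontM; apply: continuous_subspaceT; exact: exprn_continuous.
transitivity (\int[mu]_(y in cell m i) \sum_(s : 'I_n * 'I_k.+1)
  \sum_(s' : 'I_n * 'I_k.+1)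
    ((p s.1 0)`_s.2 * (q s'.1 0)`_s'.2 *
      (A y s'.1 s.1 * (y ^+ s.2 * y ^+ s'.2)))).
  apply: eq_Rintegral => y _; rewrite dotvE.
  have pE (r : 'cV[{poly R}]_n) j : (forall j, (size (r j 0%R) <= k.+1)%N) ->
      ev r y j 0 = \sum_(e < k.+1) (r j 0)`_e * y ^+ e.
    by move=> sr; rewrite evE (horner_coef_wide _ (sr j)).
  rewrite exchange_big /=.
  under [RHS]eq_bigr => s' _ do rewrite -(pair_bigA _ (fun j (e : 'I_k.+1) =>
     (p j 0)`_e * (q s'.1 0)`_s'.2 * (A y s'.1 j * (y ^+ e * y ^+ s'.2)))) /=.
  rewrite -(pair_bigA _ (fun j' (e' : 'I_k.+1) => \sum_j \sum_(e < k.+1)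
     (p j 0)`_e * (q j' 0)`_e' * (A y j' j * (y ^+ e * y ^+ e')))) /=.
  apply: eq_bigr => j' _; rewrite (pE q)// mulr_sumr; apply: eq_bigr => e' _.
  rewrite mxE mulr_suml; apply: eq_bigr => j _.
  rewrite (pE p)// mulr_sumr mulr_suml; apply: eq_bigr => e _; ring.
rewrite Rintegral_sum//; last first.
  by move=> s _; apply: integrableR_sum => // s' _;
    exact: (integrableRZ mc _ (ci s s')).
apply: eq_bigr => s _; rewrite Rintegral_sum//; last first.
  by move=> s' _; exact: (integrableRZ mc _ (ci s s')).
by apply: eq_bigr => s' _; rewrite RintegralZl.
Qed.

Lemma ip_sym n (A : R -> 'M[R]_n) i (f g : R -> 'cV[R]_n) :
  (forall y, cell m i y -> (A y)^T = A y) ->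
  ip m i (fun y => A y *m f y) g = ip m i (fun y => A y *m g y) f.
Proof.
move=> sA; apply: eq_Rintegral => y; rewrite inE => /sA Ay.
by rewrite dotvC dotv_mulmx Ay.
Qed.

End moments.

Lemma primitive_eq (R : realType) (T : R) (f f' g g' : R -> R) : 0 <= T ->
  {in `[0, T], f =1 f'} -> {in `[0, T], g =1 g'} ->
  primitive_of T f g -> primitive_of T f' g'.
Proof.
move=> T0 ff' gg' [ig fE]; split.
  apply: (eq_integrableR _ _ ig); first exact: measurable_itv.
  by move=> x; rewrite inE; exact: gg'.
move=> t tT; rewrite -!ff' ?in_itv/= ?lexx// fE//; congr (_ + _).
apply: eq_Rintegral => s; rewrite inE /= => st; apply: gg'.
move: tT st; rewrite !in_itv /= => /andP[_ tT] /andP[-> st].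
exact: le_trans tT.
Qed.

Section time_evolution.
Variables (R : realType) (b : beam R) (m : mesh R) (T : R) (k : nat).
Hypothesis coef : standing_hyps b.
Hypothesis meshP : mesh_of m (ell b).
Hypothesis T_gt0 : 0 < T.
Local Notation N := (ncells m).
Local Notation mu := (@lebesgue_measure R).
Variable u : R -> broken R ((3 + 3) + (3 + 3)).
Hypothesis uH1 : H1_Vh m k T u.

Lemma coefficient_densities :
  exists G : nat -> 'I_((3 + 3) + (3 + 3)) -> nat -> R -> R,
    forall i j d, (1 <= i <= N)%N ->
      primitive_of T (fun t => (u t i j 0)`_d) (G i j d).
Proof.
have [_ H1] := uH1.
have /choice[G GP] : forall s : nat * 'I_((3 + 3) + (3 + 3)) * nat,
  exists g : R -> R,
    (1 <= s.1.1 <= N)%N -> primitive_of T (fun t => (u t s.1.1 s.1.2 0)`_s.2) g.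
  move=> [[i j] d] /=; have [iN|_] := boolP (1 <= i <= N)%N;
    last by exists (fun=> 0).
  have [g g2 gE] := H1 i iN j d; exists g => _; split => //.
  exact: L2_time_integrable.
by exists (fun i j d => G (i, j, d)) => i j d iN; exact: (GP (i, j, d)).
Qed.

Variable G : nat -> 'I_((3 + 3) + (3 + 3)) -> nat -> R -> R.
Hypothesis GP : forall i j d, (1 <= i <= N)%N ->
  primitive_of T (fun t => (u t i j 0)`_d) (G i j d).

(** The time derivative assembled from the chosen densities; [dt_udot] identifies [dt] with it at
    almost every time. *)
Definition udot (t : R) : broken R ((3 + 3) + (3 + 3)) :=
  fun i => \col_j \poly_(d < k.+1) G i j d t.

Lemma size_udot t i j : (size (udot t i j 0%R) <= k.+1)%N.
Proof. by rewrite mxE; exact: size_poly. Qed.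

Lemma udot_coef t i j (d : 'I_k.+1) : (udot t i j 0)`_d = G i j d t.
Proof. by rewrite mxE coef_poly ltn_ord. Qed.

Lemma cell_Gam_sym i y : (1 <= i <= N)%N -> cell m i y -> (Gam b y)^T = Gam b y.
Proof. by move=> iN /(cell_sub meshP iN) yD; case: (spd_Gam_in coef yD). Qed.

Lemma wcont_cell_Gam i : (1 <= i <= N)%N -> wcont_mx (cell m i) (Gam b).
Proof. by move=> iN; apply: (wcont_cell meshP iN); exact: wcont_Gam. Qed.

(** By [ip_moments] the energy is a quadratic form in primitives. The product rule gives two
    bilinear terms, equal by the symmetry of Gamma, whence the factor 2. *)
Lemma normG2_primitive : primitive_of T (fun t => normG2 b m (u t))
  (fun t => 2 * \sum_(1 <= i < N.+1)
     ip m i (fun y => Gam b y *m ev (udot t i) y) (ev (u t i))).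
Proof.
have [Vh _] := uH1.
pose K i (s s' : 'I_((3 + 3) + (3 + 3)) * 'I_k.+1) := moment m (Gam b) i s s'.
pose c i (s : 'I_((3 + 3) + (3 + 3)) * 'I_k.+1) t := (u t i s.1 0)`_s.2.
pose g i (s : 'I_((3 + 3) + (3 + 3)) * 'I_k.+1) t := G i s.1 s.2 t.
have P : primitive_of T
    (fun t => \sum_(1 <= i < N.+1) \sum_s \sum_s' K i s s' *
      (c i s t * c i s' t))
    (fun t => \sum_(1 <= i < N.+1) \sum_s \sum_s'
        K i s s' * (c i s t * g i s' t + c i s' t * g i s t)).
  rewrite -[X in index_iota 1 X]/(N.+1).
  under eq_fun do rewrite big_nat;
    under [X in primitive_of _ _ X]eq_fun do rewrite big_nat.
  apply: primitive_sum => i iN; apply: primitive_sum => s _;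
    apply: primitive_sum => s' _.
  by apply: primitiveZ; apply: primitiveM; exact: GP.
apply: primitive_eq P; first exact: ltW.
  move=> t /Vh tV; rewrite /normG2; apply: eq_big_nat => i iN.
  rewrite (@ip_moments _ _ _ k _ _ _ _ (wcont_cell_Gam iN) (tV i iN) (tV i iN)).
  by apply: eq_bigr => s _; apply: eq_bigr => s' _; rewrite mulrC.
move=> t /Vh tV; rewrite mulr_sumr; apply: eq_big_nat => i iN.
have cG := wcont_cell_Gam iN; have sd := size_udot t i.
transitivity (ip m i (fun y => Gam b y *m ev (u t i) y) (ev (udot t i))
   + ip m i (fun y => Gam b y *m ev (udot t i) y) (ev (u t i))).
  rewrite (@ip_moments _ _ _ k _ _ _ _ cG (tV i iN) sd).
  rewrite (@ip_moments _ _ _ k _ _ _ _ cG sd (tV i iN)).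
  rewrite -big_split; apply: eq_bigr => s _; rewrite -big_split;
    apply: eq_bigr => s' _.
  by rewrite !udot_coef /= /K /c /g; ring.
rewrite ip_sym => [|y yi]; last exact: cell_Gam_sym yi.
by rewrite mulrDl mul1r.
Qed.

(** The exceptional null set must serve all cells, components and points y at once. It is the union
    of those of the countably many coefficients; y only enters through the fixed weights y^d. *)
Lemma dt_udot : {ae mu, forall t, t \in `]0, T[ ->
  forall i, (1 <= i <= N)%N -> forall y, dt u t i y = ev (udot t i) y}.
Proof.
have [Vh _] := uH1.
have : {ae mu, forall t, forall s : nat * 'I_((3 + 3) + (3 + 3)) * nat,
    (1 <= s.1.1 <= N)%N -> t \in `]0, T[ ->
    is_derive t 1 (fun t => (u t s.1.1 s.1.2 0)`_s.2) (G s.1.1 s.1.2 s.2 t)}.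
  apply: ae_forall_countType => -[[i j] d] /=.
  have [iN|_] := boolP (1 <= i <= N)%N; last by apply: aeW.
  by have := primitive_ae_is_derive (GP j d iN); apply: ae_imp => t H _;
    exact: H.
apply: ae_imp => t D tT i iN y; apply/matrixP => j j0; rewrite !mxE.
rewrite derive1E horner_poly.
have Dj (d : nat) : is_derive t 1 (fun s => (u s i j 0)`_d) (G i j d t).
  exact: (D (i, j, d) iN tT).
have := is_derive_sum (fun d : 'I_k.+1 => is_deriveZ (y ^+ d) (Dj d)).
move/near_eq_is_derive => /(_ (fun s => ev (u s i) y j 0)) [].
  (* The expansion up to degree k is valid for times in [0, T] only, which suffices near t. *)
  have := near_in_itvoo tT; apply: filterS => s sT.
  have sT' : s \in `[0, T] by apply: subset_itv_oo_cc sT.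
  rewrite fct_sumE evE (horner_coef_wide _ (Vh s sT' i iN j)).
  by apply: eq_bigr => d _; rewrite mulrC.
move=> _ ->; apply: eq_bigr => d _; rewrite mulrC; exact: erefl.
Qed.

End time_evolution.

(** * Dissipation and load power *)

Section dissipation.
Variables (R : realType) (b : beam R) (m : mesh R).
Hypothesis coef : standing_hyps b.
Hypothesis ell_gt0 : 0 < ell b.
Hypothesis meshP : mesh_of m (ell b).
Local Notation N := (ncells m).
Local Notation mu := (@lebesgue_measure R).

Lemma bdry_diss_ge0 u : 0 <= bdry_diss b m u.
Proof.
have D0 : 0 \in `[0, ell b] by rewrite in_itv /= lexx ltW.
have Dl : ell b \in `[0, ell b] by rewrite in_itv /= lexx ltW.
apply: addr_ge0; apply: spd_ge0.
  by apply: (@spd_S0_at R b 0); [exact: spd_Mass|exact: spd_Comp].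
by apply: (@spd_Sell_at R b (ell b)); [exact: spd_Mass|exact: spd_Comp].
Qed.

Lemma jump_diss_ge0 sigma u : 0 <= sigma -> 0 <= jump_diss b m sigma u.
Proof.
move=> s0; rewrite /jump_diss big_nat; apply: sumr_ge0 => i /andP[_ iN].
have xD := node_in meshP (ltnW iN).
rewrite Gam_absmx_in// dotvZl mulr_ge0 ?divr_ge0//.
rewrite -[jump m u i]vsubmxK mul_block_col !mul0mx addr0 add0r dotv_col.
rewrite addr_ge0// dotvC spd_ge0//.
  by apply: spd_S0_at; [exact: spd_Mass|exact: spd_Comp].
by apply: spd_Sell_at; [exact: spd_Mass|exact: spd_Comp].
Qed.

Lemma r_diss_ge0 r : 0 <= r_diss b m r.
Proof.
rewrite /r_diss big_nat; apply: sumr_ge0 => i iN.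
apply: Rintegral_ge0 => y /(cell_sub meshP iN) yD.
by rewrite dotvC spd_ge0//; exact/spd_inv/spd_Hmx.
Qed.

Lemma normGi2_integrand_ge0 (q : 'cV[R]_((3 + 3) + (3 + 3))) y :
  y \in `[0, ell b] -> 0 <= dotv q (invmx (Gam b y) *m q).
Proof. by move=> yD; rewrite spd_ge0//; exact/spd_inv/spd_Gam_in. Qed.

Lemma normGi2_ge0 q : (0 <= normGi2 b q)%E.
Proof. by apply: integral_ge0 => y yD; rewrite lee_fin normGi2_integrand_ge0.
  Qed.

(** Expand the form of [A] at p - A^-1 q, which is nonnegative. *)
Lemma young_spd n (A : 'M[R]_n) p q : spd A ->
  dotv p q <= 2^-1 * (dotv (A *m p) p + dotv q (invmx A *m q)).
Proof.
move=> spdA; have := spd_ge0 (p - invmx A *m q) spdA.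
rewrite mulmxBr mulKVmx ?spd_unitmx// !(dotvDl, dotvDr, dotvNl, dotvNr).
rewrite [dotv (invmx A *m q) (A *m p)]dotv_mulmx spdA.1 mulKVmx ?spd_unitmx//.
rewrite (dotvC p (A *m p)) (dotvC (invmx A *m q) q) (dotvC q p).
by move: (dotv _ _) (dotv _ _) (dotv _ _) => *; lra.
Qed.

Lemma Rintegral_cells (f : R -> R) :
  mu.-integrable `[0, ell b] (EFin \o f) ->
  \sum_(1 <= i < N.+1) \int[mu]_(y in cell m i) f y
  = \int[mu]_(y in `[0, ell b]) f y.
Proof.
move=> intf; have [_ n0 nl inc] := meshP.
suff H n : (n <= N)%N -> \sum_(1 <= i < n.+1) \int[mu]_(y in cell m i) f y
    = \int[mu]_(y in `[0, node m n]) f y by rewrite H// nl.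
elim: n => [_|n IH nN].
  by rewrite big_geq// n0 set_itv1 Rintegral_set1.
have inN : (1 <= n.+1 <= N)%N by [].
rewrite big_nat_recr//= IH; last exact: ltnW.
have xn1 := node_in meshP nN; have xn := node_in meshP (ltnW nN).
have intn : mu.-integrable `[0, node m n.+1] (EFin \o f) by
  exact: integrable_itv0 intf.
have := @Rintegral_itvB R f (BLeft 0) (BRight (node m n.+1)) (node m n) intn.
move: xn; rewrite in_itv /= => /andP[xn0 _];
  rewrite !bnd_simp => /(_ xn0 (ltW (inc _ nN))).
rewrite Rintegral_itv_obnd_cbnd; first by rewrite /cell /= => <-;
  rewrite addrC subrK.
apply: integrableS intn; [exact: measurable_itv..|].
by move=> y /=; rewrite !in_itv /= => /andP[/ltW h ->];
  rewrite (le_trans xn0 h).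
Qed.

Lemma load_power_le (u : broken R ((3 + 3) + (3 + 3)))
    (fe : R -> R -> 'cV[R]_(3 + 3)) t :
  (forall j, mu.-integrable `[0, ell b] (fun x => (fe x t j 0)%:E)) ->
  L2Gi b (qext fe t) ->
  \sum_(1 <= i < N.+1) ip m i (ev (u i)) (qext fe t)
  <= 2^-1 * (normG2 b m u + fine (normGi2 b (qext fe t))).
Proof.
move=> ife [mq qoo]; pose h y := dotv (qext fe t y)
  (invmx (Gam b y) *m qext fe t y).
have mD : measurable (`[0, ell b]%classic : set (measurableTypeR R)) by
  exact: measurable_itv.
have ih : mu.-integrable `[0, ell b] (EFin \o h).
  apply/integrableP; split.
    apply/measurable_EFinP.
    rewrite (_ : h = fun y => \sum_j qext fe t y j 0 *
      (\sum_j' invmx (Gam b y) j j' * qext fe t y j' 0)); last first.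
      by apply/funext => y; rewrite /h dotvE; apply: eq_bigr => j _;
        congr (_ * _); rewrite mxE.
    apply: measurable_sum => j; apply: measurable_funM; first exact: mq.
    apply: measurable_sum => j'; apply: measurable_funM; last exact: mq.
    by have [] := continuous_bounded_measurable (@wcont_invGam R b coef j j').
  apply: le_lt_trans qoo; rewrite le_eqVlt; apply/orP; left; apply/eqP.
  apply: eq_integral => y; rewrite inE /= => yD.
  by rewrite ger0_norm// normGi2_integrand_ge0.
have -> : fine (normGi2 b (qext fe t)) = \int[mu]_(y in `[0, ell b]) h y by [].
rewrite -(Rintegral_cells ih) /normG2 -big_split mulr_sumr /=.
rewrite [leLHS]big_nat [leRHS]big_nat; apply: ler_sum => i iN.
have mc : measurable (cell m i) by exact: measurable_itv.
have ihc : mu.-integrable (cell m i) (EFin \o h) by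
  exact: integrable_cell iN ih.
have iu : mu.-integrable (cell m i)
  (EFin \o (fun y => dotv (Gam b y *m ev (u i) y) (ev (u i) y))).
  apply: cell_dotv_integrable; last exact: wcont_ev.
  by apply: wcont_mxM; [exact: wcont_cell_Gam|exact: wcont_ev].
have iuh : mu.-integrable (cell m i)
  (EFin \o (fun y => dotv (Gam b y *m ev (u i) y) (ev (u i) y) + h y)).
  exact: integrableRD.
rewrite /ip -RintegralD// -RintegralZl//.
apply: le_Rintegral => //;
  [exact: (load_integrable meshP _ iN ife)|exact: integrableRZ|].
by move=> y /(cell_sub meshP iN) yD; apply: young_spd; exact: spd_Gam_in.
Qed.

End dissipation.

(** * Measurability in time *)

Section ae_comparison.
Context d (U : measurableType d) (R : realType)
  (nu : {measure set U -> \bar R}).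
Variables (D : set U) (mD : measurable D).

(** Meant for the dissipation: integrability of [f] is part of the conclusion, the bound by [g]
    holding only almost everywhere. *)
Lemma ae_le_integrable (f g : U -> R) : measurable_fun D f ->
  (forall x, D x -> 0 <= f x) -> nu.-integrable D (EFin \o g) ->
  {ae nu, forall x, D x -> f x <= g x} ->
  nu.-integrable D (EFin \o f) /\
  \int[nu]_(x in D) f x <= \int[nu]_(x in D) g x.
Proof.
move=> mf f0 ig fg; have mg := integrable_measurable ig.
(* The positive part is nonnegative everywhere, as the comparison of nonnegative integrals requires,
   and equals [g] wherever 0 <= f <= g. *)
pose g0 x := Num.max (g x) 0.
have mg0 : measurable_fun D g0 by apply: measurable_maxr => //;
  exact: measurable_cst.
have ig0 : nu.-integrable D (EFin \o g0).
  apply: le_integrable ig => //; first exact/measurable_EFinP.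
  move=> x _ /=; rewrite lee_fin /g0; case: (leP (g x) 0) => // _.
  by rewrite normr0.
have le0 : (\int[nu]_(x in D) (f x)%:E <= \int[nu]_(x in D) (g0 x)%:E)%E.
  apply: ae_ge0_le_integral.
  - exact: mD.
  - by move=> x Dx; rewrite lee_fin f0.
  - exact/measurable_EFinP.
  - by move=> x Dx; rewrite lee_fin /g0 le_max lexx orbT.
  - exact/measurable_EFinP.
  - by apply: ae_imp fg => x H Dx; rewrite lee_fin /g0 le_max H.
have if' : nu.-integrable D (EFin \o f).
  apply/integrableP; split; first exact/measurable_EFinP.
  under eq_integral => x xD do rewrite /= ger0_norm ?(f0 _ (set_mem xD))//.
  by apply: le_lt_trans le0 _; exact: integrable_lty.
split=> //.
have -> : \int[nu]_(x in D) g x = \int[nu]_(x in D) g0 x.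
  congr fine; apply: ae_eq_integral => //; try exact/measurable_EFinP.
  apply: ae_imp fg => x H Dx; congr EFin.
  by rewrite /g0 max_l// (le_trans _ (H Dx))// f0.
by apply: fine_le => //; exact: integrable_fin_num.
Qed.

Lemma integrable_fine (F : U -> \bar R) : nu.-integrable D F ->
  nu.-integrable D (EFin \o (fine \o F)) /\
  (\int[nu]_(x in D) (fine (F x))%:E = \int[nu]_(x in D) F x)%E.
Proof.
move=> iF; have mF := measurable_int nu iF.
have mfF : measurable_fun D (EFin \o (fine \o F)).
  apply/measurable_EFinP.
  exact: (measurableT_comp (fine_measurable measurableT)).
split.
  apply: le_integrable iF => // x _ /=.
  by case: (F x) => [r||] //=; rewrite normr0 leey.
apply: ae_eq_integral => //.
by apply: ae_imp (integrable_ae mD iF) => x H Dx; rewrite fineK ?H.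
Qed.

End ae_comparison.

Section measurability_in_time.
Variables (R : realType) (T : R).
Local Notation D := (`]0, T[%classic : set (measurableTypeR R)).

Definition meas_mx n p (A : R -> 'M[R]_(n, p)) :=
  forall i j, measurable_fun D (fun t => A t i j).

Lemma meas_mxM n p q (A : R -> 'M[R]_(n, p)) (B : R -> 'M[R]_(p, q)) :
  meas_mx A -> meas_mx B -> meas_mx (fun t => A t *m B t).
Proof.
move=> mA mB i j.
have -> : (fun t => (A t *m B t) i j) = (fun t => \sum_k A t i k * B t k j).
  by apply/funext => t; rewrite mxE.
by apply: measurable_sum => k; apply: measurable_funM; [exact: mA|exact: mB].
Qed.

Lemma meas_mx_cst n p (A : 'M[R]_(n, p)) : meas_mx (fun=> A).
Proof. by move=> i j; exact: measurable_cst. Qed.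

Lemma meas_mx_tr n p (A : R -> 'M[R]_(n, p)) : meas_mx A ->
  meas_mx (fun t => (A t)^T).
Proof.
move=> mA i j; have -> : (fun t => (A t)^T i j) = (fun t => A t j i) by
  apply/funext => t; rewrite mxE.
exact: mA.
Qed.

Lemma meas_dotv n (f g : R -> 'cV[R]_n) : meas_mx f -> meas_mx g ->
  measurable_fun D (fun t => dotv (f t) (g t)).
Proof. by move=> mf mg; exact: (meas_mxM (meas_mx_tr mf) mg). Qed.

Lemma meas_ev n (k : nat) (p : R -> 'cV[{poly R}]_n) y :
  (forall t, t \in `]0, T[ -> forall j, (size (p t j 0%R) <= k.+1)%N) ->
  (forall j d, measurable_fun D (fun t => (p t j 0)`_d)) ->
  meas_mx (fun t => ev (p t) y).
Proof.
move=> sp mp j j0; rewrite (ord1 j0).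
apply: (@eq_measurable_fun _ _ _ _ _
  (fun t => \sum_(d < k.+1) (p t j 0)`_d * y ^+ d)).
  by move=> t; rewrite inE => tT; rewrite evE (horner_coef_wide _ (sp t tT j)).
by apply: measurable_sum => d; apply: measurable_funM => //; exact: mp.
Qed.

End measurability_in_time.

Section dissipation_measurability.
Variables (R : realType) (b : beam R) (m : mesh R) (T : R) (k : nat).
Hypothesis coef : standing_hyps b.
Hypothesis meshP : mesh_of m (ell b).
Hypothesis T_gt0 : 0 < T.
Local Notation N := (ncells m).
Local Notation mu := (@lebesgue_measure R).
Local Notation D := (`]0, T[%classic : set (measurableTypeR R)).
Variable u : R -> broken R ((3 + 3) + (3 + 3)).
Hypothesis uH1 : H1_Vh m k T u.
Variable r : R -> broken R (3 + 3).
Hypothesis rL2 : L2_Vh m k T r.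

Let N0 : (0 < N)%N. Proof. by case: meshP. Qed.

Lemma meas_ev_u i y : (1 <= i <= N)%N -> meas_mx T (fun t => ev (u t i) y).
Proof.
move=> iN; apply: (@meas_ev _ _ _ k).
  by move=> t tT j; apply: uH1.1 => //; exact: subset_itv_oo_cc tT.
have [G GP] := coefficient_densities uH1.
move=> j d; have := primitive_continuous (ltW T_gt0) (GP i j d iN).
move=> /continuous_bounded_measurable[mc _].
by apply: measurable_funS mc; [exact: measurable_itv|exact: subset_itv_oo_cc].
Qed.

Lemma meas_usub n1 n2 (A : R -> 'cV[R]_(n1 + n2)) : meas_mx T A ->
  meas_mx T (fun t => usubmx (A t)) /\ meas_mx T (fun t => dsubmx (A t)).
Proof.
move=> mA; split=> i j.
  have -> : (fun t => usubmx (A t) i j) = (fun t => A t (lshift _ i) j).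
    by apply/funext => t; rewrite mxE.
  exact: mA.
have -> : (fun t => dsubmx (A t) i j) = (fun t => A t (rshift _ i) j).
  by apply/funext => t; rewrite mxE.
exact: mA.
Qed.

Lemma meas_ev_up1 i y : (1 <= i <= N)%N ->
  meas_mx T (fun t => ev (up1 (u t) i) y).
Proof.
move=> iN; have [+ _] := meas_usub (meas_ev_u y iN).
rewrite (_ : (fun t => usubmx _) = (fun t => ev (up1 (u t) i) y))//.
by apply/funext => t; rewrite ev_up1_dn2 col_mxKu.
Qed.

Lemma meas_ev_dn2 i y : (1 <= i <= N)%N ->
  meas_mx T (fun t => ev (dn2 (u t) i) y).
Proof.
move=> iN; have [_] := meas_usub (meas_ev_u y iN).
rewrite (_ : (fun t => dsubmx _) = (fun t => ev (dn2 (u t) i) y))//.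
by apply/funext => t; rewrite ev_up1_dn2 col_mxKd.
Qed.

Lemma meas_bdry_diss : measurable_fun D (fun t => bdry_diss b m (u t)).
Proof.
apply: measurable_funD; apply: meas_dotv.
- by apply: meas_ev_up1; rewrite N0.
- by apply: meas_mxM; [exact: meas_mx_cst|apply: meas_ev_up1; rewrite N0].
- by apply: meas_ev_dn2; rewrite N0 leqnn.
- by apply: meas_mxM; [exact: meas_mx_cst|apply: meas_ev_dn2; rewrite N0 leqnn].
Qed.

Lemma meas_jump_diss sigma : measurable_fun D
  (fun t => jump_diss b m sigma (u t)).
Proof.
have mj i : (1 <= i < N)%N -> meas_mx T (fun t => jump m (u t) i).
  move=> /andP[i0 iN] j j0.
  have -> : (fun t => jump m (u t) i j j0) =
    (fun t => trm m (u t) i j j0 - trp m (u t) i j j0).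
    by apply/funext => t; rewrite /jump !mxE.
  by apply: measurable_funB; apply: meas_ev_u; rewrite ?i0 ?(ltnW iN).
rewrite /jump_diss.
(* The guard makes every summand measurable, including at indices outside the range. *)
have -> : (fun t => \sum_(1 <= i < N) dotv ((sigma / 2) *: (Gam b (node m i) *m
       absmx (Amx b (node m i)) *m jump m (u t) i)) (jump m (u t) i))
  = (fun t => \sum_(i <- index_iota 1 N) if (1 <= i < N)%N then
        (sigma / 2) * dotv ((Gam b (node m i) *m absmx (Amx b (node m i)))
          *m jump m (u t) i) (jump m (u t) i) else 0).
  apply/funext => t; apply: eq_big_nat => i iN.
  by rewrite iN dotvZl.
apply: measurable_sum => i; case iN: (1 <= i < N)%N; last exact: measurable_cst.
apply: measurable_funM; first exact: measurable_cst.
apply: meas_dotv; last exact: mj.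
by apply: meas_mxM; [exact: meas_mx_cst|exact: mj].
Qed.

(** Through the moments, an integral in x depending on t becomes a quadratic polynomial in the
    measurable coefficients of r. *)
Lemma meas_r_diss : measurable_fun D (fun t => r_diss b m (r t)).
Proof.
have [rV rc] := rL2.
apply: (@eq_measurable_fun _ _ _ _ _ (fun t => \sum_(i <- index_iota 1 N.+1)
   if (1 <= i < N.+1)%N then
   \sum_(s : 'I_(3 + 3) * 'I_k.+1) \sum_(s' : 'I_(3 + 3) * 'I_k.+1)
    (r t i s.1 0)`_s.2 * (r t i s'.1 0)`_s'.2 * moment m
      (fun y => invmx (Hmx b y)) i s s'
   else 0)).
  move=> t; rewrite inE => tT; apply: eq_big_nat => i iN; rewrite iN.
  have cH : wcont_mx (cell m i) (fun y => invmx (Hmx b y)).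
    by apply: (wcont_cell meshP iN); exact: wcont_invHmx.
  by rewrite (@ip_moments _ _ _ k _ _ _ _ cH (rV t tT i iN) (rV t tT i iN)).
apply: measurable_sum => i; case iN: (1 <= i < N.+1)%N;
  last exact: measurable_cst.
apply: measurable_sum => s; apply: measurable_sum => s'.
apply: measurable_funM; last exact: measurable_cst.
by apply: measurable_funM; [case: (rc i iN s.1 s.2)|case: (rc i iN s'.1 s'.2)].
Qed.

End dissipation_measurability.

(** * Energy estimate *)

(** Multiplied by exp(-t), the inequality bounds the derivative of exp(-t) E plus 2 exp(-t) D by
    exp(-t) q. Integration over ]0, T[ and multiplication by exp(T) give the claim. *)
Lemma gronwall_primitive (R : realType) (T : R) (E e D q : R -> R) : 0 < T ->
  primitive_of T E e ->
  measurable_fun `]0, T[ D -> (forall t, t \in `]0, T[ -> 0 <= D t) ->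
  (@lebesgue_measure R).-integrable `]0, T[ (EFin \o q) ->
  (forall t, t \in `]0, T[ -> 0 <= q t) ->
  {ae @lebesgue_measure R, forall t, t \in `]0,
    T[ -> e t + 2 * D t <= E t + q t} ->
  (@lebesgue_measure R).-integrable `]0, T[ (EFin \o D) /\
  E T + 2 * \int[@lebesgue_measure R]_(t in `]0, T[) D t
  <= expR T * (E 0 + \int[@lebesgue_measure R]_(t in `]0, T[) q t).
Proof.
move=> T0 pE mD D0 iq q0 De.
have mI : measurable (`]0, T[%classic : set (measurableTypeR R)) by
  exact: measurable_itv.
have [ipsi psiE] := primitiveM (primitive_expRN T0) pE.
set psi := (fun t => expR (- t) * e t + _) in ipsi psiE.
have ipsi' : (@lebesgue_measure R).-integrable `]0, T[ (EFin \o psi).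
  by apply: integrableS ipsi; [exact: measurable_itv..|exact: subset_itv_oo_cc].
have ig := integrableRB mI iq ipsi'.
(* A constant lower bound for the weight 2 exp(-t) in front of [D], so that [D] itself is dominated
   by the integrable q - psi, where psi is the derivative of exp(-t) E. *)
pose c := 2 * expR (- T); have c0 : 0 < c by rewrite mulr_gt0 ?expR_gt0.
have [|||iD le] := @ae_le_integrable _ _ R (@lebesgue_measure R) _ mI
  (fun t => c * D t) _ _ _ ig.
- by apply: measurable_funM => //; exact: measurable_cst.
- by move=> t tT; apply: mulr_ge0; [exact: ltW|exact: D0].
- apply: ae_imp De => t H tT; have := H tT; have := D0 t tT; have := q0 t tT.
  move: tT; rewrite /= in_itv /= => /andP[t0 tT] q0t D0t Ht.
  have e1 : expR (- T) <= expR (- t) by rewrite ler_expR lerN2 ltW.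
  have e2 : expR (- t) <= 1 by rewrite -expR0 ler_expR oppr_le0 ltW.
  have h1 : 2 * expR (- T) * D t <= expR (- t) * (2 * D t).
    by rewrite mulrAC mulrC ler_wpM2r// mulr_ge0.
  have h2 : expR (- t) * (e t + 2 * D t) <= expR (- t) * (E t + q t).
    by rewrite ler_wpM2l// expR_ge0.
  have h3 : expR (- t) * q t <= q t by rewrite ler_piMl.
  by rewrite /c /psi; lra.
have iD' : (@lebesgue_measure R).-integrable `]0, T[ (EFin \o D).
  have := integrableRZ mI c^-1 iD; congr (integrable _ _ _).
  by apply/funext => t /=; rewrite mulKf// gt_eqF.
split=> //.
rewrite RintegralZl// RintegralB// in le.
have psiI : \int[@lebesgue_measure R]_(t in `]0, T[) psi t
    = expR (- T) * E T - E 0.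
  have := psiE T; rewrite in_itv /= lexx ltW// => /(_ isT).
  rewrite oppr0 expR0 mul1r => ->; rewrite addrC addKr /Rintegral.
  by rewrite [in RHS](integral_itv_bndoo (f := EFin \o psi))//;
    exact: (measurable_int (@lebesgue_measure R)).
rewrite psiI /c in le.
have eT : expR T * expR (- T) = 1 by rewrite expRN mulfV// gt_eqF// expR_gt0.
have := ler_wpM2l (expR_ge0 T) le.
move: eT; move: (expR T) (expR (- T)) (E T) (E 0) => a a' ET E0 aa'.
move: (\int[_]_(_ in _) _) (\int[_]_(_ in _) _) => y x.
rewrite (_ : a * (2 * a' * x) = a * a' * (2 * x)); last by ring.
rewrite (_ : a * (y - (a' * ET - E0)) = a * (E0 + y) - a * a' * ET);
  last by ring.
by rewrite aa' !mul1r; lra.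
Qed.

Theorem theorem4p2 (R : realType) (b : beam R) (T : R) (m : mesh R) (k : nat)
    (fe : R -> R -> 'cV[R]_(3 + 3)) (sigma : R)
    (u : R -> broken R ((3 + 3) + (3 + 3))) (r : R -> broken R (3 + 3))
    (u0 : broken R ((3 + 3) + (3 + 3)))
    (uh rh : R -> nat -> 'cV[R]_(3 + 3))
    (ell_gt0 : 0 < ell b) (T_gt0 : 0 < T)
    (coef : standing_hyps b)
    (meshP : mesh_of m (ell b))
    (fe_int : {ae @lebesgue_measure R, forall t, t \in `]0, T[ ->
       forall j, (@lebesgue_measure R).-integrable `[0, ell b]
                   (fun x => (fe x t j 0)%:E)})
    (sigma_ge0 : 0 <= sigma)
    (uH1 : H1_Vh m k T u)
    (rL2 : L2_Vh m k T r)
    (u0_Vh : in_Vh m k u0)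
    (u_init : forall i, (1 <= i <= ncells m)%N -> u 0 i = u0 i)
    (traces :
       [\/ {ae @lebesgue_measure R, forall t, t \in `]0, T[ ->
              alternating_pair m (u t) (r t) (uh t) (rh t)},
           {ae @lebesgue_measure R, forall t, t \in `]0, T[ ->
              BR1_pair m (u t) (r t) (uh t) (rh t)} |
           {ae @lebesgue_measure R, forall t, t \in `]0, T[ ->
              compatible_pair m (u t) (r t) (uh t) (rh t)}])
    (DG : {ae @lebesgue_measure R, forall t, t \in `]0, T[ ->
       forall (v : broken R ((3 + 3) + (3 + 3))) (w : broken R (3 + 3)),
         in_Vh m k v -> in_Vh m k w ->
         DG1 b m fe sigma u r rh t v /\ DG2 b m u r uh t w}) :
  [/\ forall t, t \in `[0, T] -> 0 <= bdry_diss b m (u t),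
      {ae @lebesgue_measure R, forall t, t \in `]0, T[ ->
         derivable (fun s => normG2 b m (u s)) t 1 /\
         2^-1 * derive1 (fun s => normG2 b m (u s)) t
         + jump_diss b m sigma (u t) + r_diss b m (r t) + bdry_diss b m (u t)
         = \sum_(1 <= i < (ncells m).+1) ip m i (ev (u t i)) (qext fe t)} &
      L2_L2Gi b T (qext fe) ->
      ((normG2 b m (u T))%:E
       + 2%:E * \int[@lebesgue_measure R]_(t in `]0%R, T[)
                   (jump_diss b m sigma (u t))%:E
       + 2%:E * \int[@lebesgue_measure R]_(t in `]0%R, T[)
                   (r_diss b m (r t))%:E
       + 2%:E * \int[@lebesgue_measure R]_(t in `]0%R, T[)
                   (bdry_diss b m (u t))%:E
       <= (expR T)%:E *
          ((normG2 b m u0)%:E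
           + \int[@lebesgue_measure R]_(t in `]0%R, T[)
               normGi2 b (qext fe t)))%E].
Proof.
have [G GP] := coefficient_densities uH1.
have comp : {ae @lebesgue_measure R, forall t, t \in `]0, T[ ->
    compatible_pair m (u t) (r t) (uh t) (rh t)}.
  case: traces => [|| //]; apply: ae_imp => t H tT;
    apply: trace_pair_compatible;
    [left|right]; exact: H.
have rate : {ae @lebesgue_measure R, forall t, t \in `]0, T[ ->
    is_derive t 1 (fun s => normG2 b m (u s))
      (2 * \sum_(1 <= i < (ncells m).+1)
         ip m i (fun y => Gam b y *m dt u t i y) (ev (u t i)))}.
  have P := primitive_ae_is_derive (normG2_primitive coef meshP T_gt0 uH1 GP).
  apply: ae_imp (ae_and P (dt_udot uH1 GP)) => t [P1 P2] tT.
  have := P1 tT; congr (is_derive _ _ _ _); congr (2 * _).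
  apply: eq_big_nat => i iN.
  by apply: eq_Rintegral => y _; rewrite P2.
have bal : {ae @lebesgue_measure R, forall t, t \in `]0, T[ ->
    \sum_(1 <= i < (ncells m).+1) ip m i (fun y => Gam b y *m dt u t i y)
      (ev (u t i))
    + jump_diss b m sigma (u t) + r_diss b m (r t) + bdry_diss b m (u t)
    = \sum_(1 <= i < (ncells m).+1) ip m i (ev (u t i)) (qext fe t)}.
  apply: ae_imp (ae_and (ae_and comp DG) fe_int) => t [[H1 H2] H3] tT.
  have uV : in_Vh m k (u t) by apply: uH1.1; exact: subset_itv_oo_cc tT.
  have [d1 d2] := H2 tT (u t) (r t) uV (rL2.1 t tT).
  exact: (power_balance coef ell_gt0 meshP (H3 tT) (H1 tT) d1 d2).
split.
- by move=> t _; exact: bdry_diss_ge0.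
- apply: ae_imp (ae_and rate bal) => t [H1 H2] tT; have [d1 d2] := H1 tT.
  split; first exact: d1.
  by rewrite derive1E d2 mulKf// H2.
case=> q2 _ q3.
pose q t := fine (normGi2 b (qext fe t)).
pose D t := jump_diss b m sigma (u t) + r_diss b m (r t) + bdry_diss b m (u t).
have mI : measurable (`]0, T[%classic : set (measurableTypeR R)) by
  exact: measurable_itv.
have mJ := meas_jump_diss b T_gt0 uH1 sigma.
have mR := meas_r_diss coef meshP rL2.
have mB := meas_bdry_diss meshP T_gt0 uH1.
have J0 t : 0 <= jump_diss b m sigma (u t) by exact: jump_diss_ge0.
have R0 t : 0 <= r_diss b m (r t) by exact: r_diss_ge0.
have B0 t : 0 <= bdry_diss b m (u t) by exact: bdry_diss_ge0.
have [iq qE] := integrable_fine mI q3.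
have [||||iD le] := gronwall_primitive (D := D) T_gt0
  (normG2_primitive coef meshP T_gt0 uH1 GP) _ _ iq.
- by apply: measurable_funD => //; exact: measurable_funD.
- by move=> t _; exact: addr_ge0 (addr_ge0 (J0 t) (R0 t)) (B0 t).
- by move=> t _; apply: fine_ge0; exact: normGi2_ge0.
- apply: ae_imp (ae_and (ae_and (ae_and bal (dt_udot uH1 GP)) fe_int) q2) => t.
  move=> [[[H1 H2] H3] H4] tT;
    have := load_power_le coef meshP (u t) (H3 tT) (H4 tT).
  rewrite -H1//.
  (* The density supplied by [normG2_primitive] is written with [udot], the balance with [dt]; they
     agree at this t by [H2]. *)
  under eq_big_nat => i iN.
    rewrite (_ : ip _ _ _ _ = ip m i (fun y => Gam b y *m ev (udot k G t i) y)
      (ev (u t i))); last first.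
      by apply: eq_Rintegral => y _; rewrite H2.
    over.
  rewrite /D /q /=.
  move: (jump_diss _ _ _ _) (r_diss _ _ _) (bdry_diss _ _ _)
    (\sum_(_ <= _ < _) _) (normG2 _ _ _) (fine _).
  by move=> *; lra.
(* Only the sum of the three dissipations is known to be integrable so far. Each is nonnegative and
   at most the sum, hence integrable, and the extended integrals of the claim become real
   numbers. *)
have part (f : R -> R) : measurable_fun `]0,
  T[ f -> (forall t, 0 <= f t <= D t) ->
    (@lebesgue_measure R).-integrable `]0, T[ (EFin \o f).
  move=> mf fD; apply: le_integrable iD => //; first exact/measurable_EFinP.
  move=> t _ /=; have /andP[f0 fd] := fD t.
  by rewrite lee_fin !ger0_norm// (le_trans f0).
have iJ : (@lebesgue_measure R).-integrable `]0,
  T[ (EFin \o (fun t => jump_diss b m sigma (u t))).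
  by apply: part => // t; rewrite J0 /D -addrA lerDl addr_ge0.
have iR : (@lebesgue_measure R).-integrable `]0,
  T[ (EFin \o (fun t => r_diss b m (r t))).
  by apply: part => // t; rewrite R0 /D addrAC lerDr addr_ge0.
have iB : (@lebesgue_measure R).-integrable `]0,
  T[ (EFin \o (fun t => bdry_diss b m (u t))).
  by apply: part => // t; rewrite B0 /D lerDr addr_ge0.
have toE (f : R -> R) : (@lebesgue_measure R).-integrable `]0, T[ (EFin \o f) ->
    (\int[@lebesgue_measure R]_(t in `]0%R, T[) (f t)%:E
     = (\int[@lebesgue_measure R]_(t in `]0, T[) f t)%:E)%E.
  by move=> i; rewrite /Rintegral fineK//; exact: integrable_fin_num i.
rewrite -qE (toE _ iJ) (toE _ iR) (toE _ iB) (toE _ iq).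
rewrite -!EFinM -!EFinD lee_fin.
have <- : normG2 b m (u 0) = normG2 b m u0.
  by apply: eq_big_nat => i iN; rewrite u_init.
move: le; rewrite /D RintegralD//; last exact: integrableRD.
rewrite RintegralD// => le; apply: le_trans le.
by rewrite !mulrDr !addrA.
Qed.
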